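(* Let $\phi$ be a Sturmian coloring of bounded type of a $k$-regular tree $T$, and let $X=T/\sim$ be the edge-indexed quotient graph of $T$ obtained by identifying vertices with the same maximal type. Then $\phi$ is eventually periodic if and only if $X$ is one of the following two edge-indexed graphs: (i) a ray with vertices $v_0,v_1,v_2,\dots$, one edge joining $v_i$ and $v_{i+1}$ for each $i\ge 0$, one loop of index $1$ at $v_0$, and no other edges, such that for every $i\ge 0$ the index of the oriented edge $[v_i,v_{i+1}]$ is $k-1$ and the index of $[v_{i+1},v_i]$ is $1$; (ii) a ray with vertices $v_0,v_1,v_2,\dots$, one edge joining $v_i$ and $v_{i+1}$ for each $i\ge 0$, and no other edges, such that the index of $[v_0,v_1]$ is $k$, the index of $[v_i,v_{i+1}]$ is $k-1$ for every $i\ge 1$, and the index of $[v_{i+1},v_i]$ is $1$ for every $i\ge 0$.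
   Context: $T$ is a $k$-regular tree ($k\ge 2$) with vertex set $VT$. A coloring is a map $\phi:VT\to\mathcal{A}$ with $\mathcal{A}$ a countable set. $B_n(x)$ is the ball of radius $n$ around the vertex $x$ (edges of length $1$). $[B_n(x)]$ denotes the equivalence class of $B_n(x)$ under color-preserving graph isomorphisms between $n$-balls (a colored $n$-ball). $b_\phi(n)$ is the number of distinct colored $n$-balls in $T$; $\phi$ is Sturmian if $b_\phi(n)=n+2$ for all $n\ge 0$. A colored $n$-ball $[B]$ is special if there are vertices $x,y$ with $[B_n(x)]=[B_n(y)]=[B]$ and $[B_{n+1}(x)]\ne[B_{n+1}(y)]$. The type set of a vertex $x$ is $\Lambda_x=\{n\ge 0:[B_n(x)]\text{ is special}\}$. A vertex is of bounded type if $\Lambda_x$ is finite; then its maximal type $\tau(x)$ is $\max\Lambda_x$, or $-1$ if $\Lambda_x=\emptyset$. The coloring is of bounded type if some vertex is of bounded type (in which case every vertex is). The relation $\sim$ on $VT$ is: $v\sim w$ iff $\tau(v)=\tau(w)$. For a Sturmian coloring of bounded type, two vertices with the same maximal type are related by a color-preserving automorphism of $T$. The graph $X=T/\sim$ has vertex set $VT/\sim$; it has an oriented edge $[p,q]$ (a loop if $p=q$) whenever some vertex in the class $p$ is adjacent in $T$ to a vertex in the class $q$, and the index of $[p,q]$ is the number of neighbors in the class $q$ of any vertex in the class $p$. A coloring is periodic if it is invariant under some (not necessarily discrete) group $\Gamma$ of automorphisms of $T$ with $\Gamma\backslash T$ finite. A coloring $\phi$ is eventually periodic if there is a subtree $K$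 of $T$ with finitely many vertices such that $T-K=\bigcup T_i$ is a finite union of subtrees $T_i$ such that for each $i$ there is a periodic coloring $\phi_i$ of $T$ with $\phi_i|_{T_i}=\phi|_{T_i}$. *)

(* Defs.v *)
From mathcomp Require Import all_boot all_order all_algebra.
From mathcomp Require Import boolp classical_sets functions cardinality.

Set Implicit Arguments.
Unset Strict Implicit.
Unset Printing Implicit Defensive.

Local Open Scope classical_set_scope.
Local Open Scope card_scope.

(* A graph, possibly infinite, is given by its adjacency relation [adj]. *)
Section Tree.
Variables (V : choiceType) (adj : rel V).

Definition neighbors (x : V) : set V := [set y | adj x y].

Definition is_tree : Prop :=
  [/\ symmetric adj,
      irreflexive adj,
      (forall x y, exists2 p, path adj x p & last x p = y)
    & (* [ucycle adj c] also holds for [::] and for [:: x; y], x -- y *)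
      forall c : seq V, ucycle adj c -> (size c <= 2)%N].

Definition regular_tree (k : nat) : Prop :=
  is_tree /\ forall x, neighbors x #= `I_k.

Definition ball (n : nat) (x : V) : set V :=
  [set y | exists p : seq V,
     [/\ path adj x p, last x p = y & (size p <= n)%N]].

Definition subtree (S : set V) : Prop :=
  S !=set0 /\
  forall x y, S x -> S y ->
    exists p : seq V,
      [/\ path adj x p, last x p = y & forall z, z \in p -> S z].

Definition automorphism (g : V -> V) : Prop :=
  bijective g /\ forall x y, adj (g x) (g y) = adj x y.

Definition automorphism_group (G : set (V -> V)) : Prop :=
  [/\ forall g, G g -> automorphism g,
      G id,
      forall g h, G g -> G h -> G (g \o h)
    & forall g h, G g -> cancel g h -> cancel h g -> G h].

Definition orbit_of (G : set (V -> V)) (x : V) : set V := [set g x | g in G].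

Definition cofinite_group (G : set (V -> V)) : Prop :=
  finite_set (range (orbit_of G)).

End Tree.

Section Coloring.
Variables (V : choiceType) (adj : rel V) (A : countType) (phi : V -> A).

(* Nothing is required of the centers: an isomorphism between n-balls of a
   k-regular tree, k >= 2, sends center to center. *)
Definition ball_iso (n : nat) (x y : V) : Prop :=
  exists f : V -> V,
    [/\ set_bij (ball adj n x) (ball adj n y) f,
        (forall u v, ball adj n x u -> ball adj n x v ->
           adj (f u) (f v) = adj u v)
      & forall u, ball adj n x u -> phi (f u) = phi u].

(* The class [B_n(x)], encoded as the set of the centers of the n-balls
   isomorphic to B_n(x). *)
Definition colored_ball (n : nat) (x : V) : set V := [set y | ball_iso n x y].

Definition sturmian : Prop :=
  forall n : nat, range (colored_ball n) #= `I_(n + 2).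

Definition special (n : nat) (B : set V) : Prop :=
  exists x y, [/\ colored_ball n x = B, colored_ball n y = B
                & colored_ball n.+1 x <> colored_ball n.+1 y].

Definition type_set (x : V) : set nat := [set n | special n (colored_ball n x)].

Definition bounded_type : Prop := exists x, finite_set (type_set x).

(* max Lambda_x, or -1 if Lambda_x is empty (and, as a junk value, if
   Lambda_x is infinite). *)
Definition max_type (x : V) : int :=
  xget (-1)%R [set (n%:Z)%R | n in
    [set n | type_set x n /\ forall m, type_set x m -> (m <= n)%N]].

Definition periodic : Prop :=
  exists G : set (V -> V),
    [/\ automorphism_group adj G,
        cofinite_group G
      & forall g, G g -> forall x, phi (g x) = phi x].

(* The quotient X = T/~ : its vertices are the ~-classes. *)
Definition sim (v w : V) : Prop := max_type v = max_type w.

Definition sim_class (v : V) : set V := [set w | sim v w].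

Definition X_vertices : set (set V) := range sim_class.

Definition X_edge (p q : set V) : Prop := exists x y, [/\ p x, q y & adj x y].

Definition X_index_is (p q : set V) (m : nat) : Prop :=
  forall x, p x -> neighbors adj x `&` q #= `I_m.

End Coloring.

(* T - K is the union of the S i as vertex sets; the S i may overlap. *)
Definition eventually_periodic (V : choiceType) (adj : rel V) (A : countType)
    (phi : V -> A) : Prop :=
  exists K : set V,
    [/\ subtree adj K, finite_set K
      & exists (m : nat) (S : 'I_m -> set V),
          ~` K = \bigcup_i S i /\
          forall i, subtree adj (S i) /\
            exists psi : V -> A,
              periodic adj psi /\ forall x, S i x -> psi x = phi x].

(* An edge-indexed graph without multiple edges; [eig_index i j] is meaningful
   only when [eig_edge i j] holds. *)
Record eigraph := EIGraph {
  eig_vertex : Type;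
  eig_edge : eig_vertex -> eig_vertex -> Prop;
  eig_index : eig_vertex -> eig_vertex -> nat }.

(* X = T/~ is isomorphic to G as an edge-indexed graph. *)
Definition quotient_is (V : choiceType) (adj : rel V) (A : countType)
    (phi : V -> A) (G : eigraph) : Prop :=
  exists v : eig_vertex G -> set V,
    [/\ set_bij [set: eig_vertex G] (X_vertices adj phi) v,
        forall i j, X_edge adj (v i) (v j) <-> eig_edge i j
      & forall i j, eig_edge i j ->
          X_index_is adj (v i) (v j) (eig_index i j)].

Definition looped_ray (k : nat) : eigraph := {|
  eig_vertex := nat;
  eig_edge := fun i j => [\/ j = i.+1, i = j.+1 | i = 0 /\ j = 0];
  eig_index := fun i j => if j == i.+1 then (k - 1)%N else 1%N |}.

Definition plain_ray (k : nat) : eigraph := {|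
  eig_vertex := nat;
  eig_edge := fun i j => j = i.+1 \/ i = j.+1;
  eig_index := fun i j =>
    if j == i.+1 then (if i == 0 then k else (k - 1)%N) else 1%N |}.

(* Main.v *)
(* Isomorphism of colored n-balls is a color refinement: the (n+1)-ball of x is
   given by its color and the multiset of the n-balls of its neighbors. In a
   Sturmian coloring exactly one class splits at each level, into two, and the
   class splitting at level n+1 is adjacent to both halves of the previous one.
   Let C be the class that stops splitting first, at level mu+1. Counting shows
   that at each later level precisely the next sphere around C becomes final;
   hence the vertices of X are the spheres l = i, where l(x) = d(x, C), and away
   from C the classes of level mu form a finite equitable partition.

   X is one of the two rays iff every vertex has at most one neighbor that is
   not strictly farther from C. In that case C is a vertex or an edge, the color
   depends periodically on l >= 1, and on each branch hanging off C the coloring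
   agrees with a periodic function of a Busemann function. Otherwise C is
   infinite, and a periodic coloring that agrees with phi both deep in a branch
   avoiding C and along infinitely much of C would make C look like the vertices
   far away from C. *)
Require Import Defs.
From mathcomp Require Import all_boot all_order all_algebra.
From mathcomp Require Import boolp classical_sets functions cardinality.
From mathcomp Require Import zify.

Set Implicit Arguments.
Unset Strict Implicit.
Unset Printing Implicit Defensive.

Local Open Scope classical_set_scope.
Local Open Scope card_scope.

(** * Finite sequences *)

(** A periodic coloring can be refuted only through balls that it shares with $\phi$, and by
    [lev_sep] recognizing a vertex of C takes its whole [mu]-ball. What a piece is known to contain
    near C is the set [l <= j], where [j] is the last level with two neighbors not farther from C;
    it contains [mu]-balls around C only if [mu <= j]. For [j < mu] other arguments are needed: if
    [j > 0], the equitable partition away from C is so rigid that [mu <= 1]; if [j = 0], a long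
    geodesic inside C replaces the ball, since its translate far from C climbs through many
    consecutive levels and gives them all one color, which forces [mu = 0]. The pieces are arbitrary
    subtrees and may overlap, so the argument moves to a vertex beyond which each piece either
    contains all of [l <= j] or misses the branch altogether. *)

Lemma card_eq_seq (T : choiceType) (A : set T) (n : nat) :
  A #= `I_n <->
  exists s : seq T, [/\ uniq s, size s = n & forall x, (x \in s) = `[< A x >]].
Proof.
split=> [An | [s [us <- As]]].
  exists (finmap.enum_fset (fset_set A)); split=> //.
  - exact: card_fset_set.
  - move=> x; have fA : finite_set A by apply/finite_setP; exists n.
    by rewrite (in_fset_set fA x); apply/idP/asboolP; rewrite in_setE.
have AE x : A x <-> x \in s by rewrite As; split=> /asboolP.
apply/card_set_bijP; exists (index^~ s); split.
- by move=> x /AE; rewrite /= index_mem.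
- move=> x y; rewrite !in_setE => /AE xs /AE ys /(congr1 (nth x s)).
  by rewrite !nth_index.
- move=> i /= ilt; case: s us As AE ilt => // a s us _ AE ilt.
  exists (nth a (a :: s) i); first by apply/AE; exact: mem_nth.
  by rewrite index_uniq.
Qed.

(** Turns an equality of multisets of neighbor classes into an actual matching of the neighbors. *)
Lemma perm_map_lift (T U : eqType) (r : T -> U) (s s' : seq T) :
  perm_eq (map r s) (map r s') ->
  exists s'', perm_eq s'' s' /\ map r s'' = map r s.
Proof.
case: s' => [|a s'].
  by move=> /= /perm_nilP; case: s => // _; exists [::].
move=> /(perm_iotaP (r a)) [Is pI ->]; exists (map (nth a (a :: s')) Is); split.
  by apply/(perm_iotaP a); exists Is => //; rewrite size_map in pI.
rewrite -map_comp; apply/eq_in_map => i.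
rewrite (perm_mem pI) mem_iota size_map /= => ilt.
by rewrite -(nth_map a (r a) r).
Qed.

Lemma perm_map_rem (T U : eqType) (r : T -> U) (s s' : seq T) p q :
  p \in s -> q \in s' -> r p = r q -> perm_eq (map r s) (map r s') ->
  perm_eq (map r (rem p s)) (map r (rem q s')).
Proof.
move=> /perm_to_rem/(perm_map r) ps /perm_to_rem/(perm_map r) qs rpq.
by rewrite (permPl ps) (permPr qs) /= rpq perm_cons.
Qed.

(** Two different collisions would allow two elements to be removed from [s] without losing a value
    of [f], and at most [size t - 1] elements would be left to cover [t]. *)
Lemma collision_unique (T U : eqType) (f : T -> U) (s : seq T) (t : seq U) a b c d :
  uniq s -> uniq t -> size s <= (size t).+1 -> {subset t <= map f s} ->
  a \in s -> b \in s -> c \in s -> d \in s ->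
  a != b -> f a = f b -> c != d -> f c = f d ->
  c = a /\ d = b \/ c = b /\ d = a.
Proof.
move=> us ut st ts as_ bs cs ds ab fab cd fcd.
have one x y : x \in s -> y \in s -> x != y -> f x = f y -> c = x \/ d = x.
  move=> xs ys xy fxy; have [->|cx] := eqVneq c x; first by left.
  have [->|dx] := eqVneq d x; first by right.
  exfalso; set s' := rem c (rem x s).
  have us' : uniq (rem x s) by apply: rem_uniq.
  have mem_s' z : z \in s -> z != x -> z != c -> z \in s'.
    by move=> zs zx zc; rewrite /s' mem_rem_uniq // !inE zc mem_rem_uniq // !inE zx.
  have cxs : c \in rem x s by rewrite mem_rem_uniq // !inE cx.
  have xsE := size_rem xs; have csE := size_rem cxs.
  have s0 : 0 < size s by case: (s) xs.
  have sx0 : 0 < size (rem x s) by case: (rem x s) cxs.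
  have : size t <= size (map f s').
    apply: uniq_leq_size ut _ => u /ts /mapP [z zs ->].
    have fd : f c \in map f s' by rewrite fcd map_f // mem_s' // eq_sym.
    have fz w : w \in s -> w != x -> f w \in map f s'.
      by move=> ws wx; have [->//|wc] := eqVneq w c; rewrite map_f // mem_s'.
    have [->|zx] := eqVneq z x; last exact: fz.
    by rewrite fxy fz // eq_sym.
  move: st s0 sx0; rewrite size_map csE xsE.
  by move: (size s) (size t); clear; lia.
have ba : b != a by rewrite eq_sym.
have [ac|ad] := one a b as_ bs ab fab; have [bc|bd] := one b a bs as_ ba (esym fab).
- by rewrite -ac -bc eqxx in ab.
- by left.
- by right.
- by rewrite -ad -bd eqxx in ab.
Qed.

Lemma map_eq_transfer (T U W : eqType) (f : T -> U) (g : T -> W) (s s' : seq T) :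
  map f s = map f s' ->
  (forall a b, a \in s -> b \in s' -> f a = f b -> g a = g b) ->
  map g s = map g s'.
Proof.
elim: s s' => [|a s IH] [|b s'] //= [fab fs] H; congr (_ :: _).
  by apply: H; rewrite ?inE ?eqxx.
by apply: IH => // c d cs ds; apply: H; rewrite inE ?cs ?ds orbT.
Qed.

Lemma pigeonhole (T : eqType) (f : nat -> T) (s : seq T) :
  (forall i, f i \in s) -> exists i j, i < j /\ f i = f j.
Proof.
move=> fs; apply: contrapT => inj; have : uniq (mkseq f (size s).+1).
  apply/mkseq_uniqP => i j _ _ fij; apply/eqP; apply: contraT.
  rewrite neq_ltn => /orP[ij|ij]; case: inj; first by exists i, j.
  by exists j, i.
move=> /uniq_leq_size le; suff : size (mkseq f (size s).+1) <= size s.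
  by rewrite size_mkseq ltnn.
by apply: le => _ /mapP [i _ ->].
Qed.

(** If [b] and [d] differed, [b] would occur at least twice on the left and at most once on the
    right. For [n = 1] the two entries could be swapped. *)
Lemma perm_cons_nseq (T : eqType) (a b c d : T) n : 2 <= n ->
  perm_eq (a :: nseq n b) (c :: nseq n d) -> a = c /\ b = d.
Proof.
move=> n2 pE; have bd : b = d.
  apply/eqP; apply: contraT => nbd; have /permP/(_ (pred1 b)) := pE.
  rewrite /= !count_nseq /= eqxx (eq_sym d) (negPf nbd).
  by case: (a == b); case: (c == b); lia.
split=> //; move: pE; rewrite bd -cat1s -[c :: _]cat1s perm_cat2r.
by move/perm_mem/(_ a); rewrite !inE eqxx => /esym/eqP.
Qed.

(** An injective walk with unit steps never turns back; a descending one would run out of numbers,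
    and an ascending one that visits 0 starts there. *)
Lemma nat_unit_steps (f : nat -> nat) : injective f -> (exists a, f a = 0) ->
  (forall a, f a.+1 = (f a).+1 \/ f a = (f a.+1).+1) -> forall a, f a = a.
Proof.
move=> finj [a0 fa0] step.
have [up|down] := step 0.
  have fE a : f a = f 0 + a /\ f a.+1 = f 0 + a.+1.
    elim: a => [|a [IH0 IH1]]; first by rewrite addn0 addn1.
    split=> //; have [->|E] := step a.+1; first by lia.
    by have /finj : f a.+2 = f a; lia.
  by move=> a; have [] := fE a; have [] := fE a0; lia.
have fE a : f a + a = f 0 /\ f a.+1 + a.+1 = f 0.
  elim: a => [|a [IH0 IH1]]; first by rewrite addn0 addn1.
  split=> //; have [E|E] := step a.+1; last by lia.
  by have /finj : f a.+2 = f a; lia.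
by have [] := fE (f 0).+1; lia.
Qed.

(** * Trees *)

Section Tree.
Variables (V : choiceType) (adj : rel V).

Definition dist (x y : V) : nat :=
  xget 0 [set n | ball adj n x y /\ forall m, ball adj m x y -> n <= m].

Definition nb (x : V) : seq V :=
  xget [::] [set s | uniq s /\ forall y, (y \in s) = adj x y].

Hypothesis tr : is_tree adj.

Lemma adjC x y : adj x y = adj y x.
Proof. by case: tr. Qed.

Lemma adjxx x : adj x x = false.
Proof. by case: tr. Qed.

Lemma adj_neq x y : adj x y -> x != y.
Proof. by apply: contraTneq => ->; rewrite adjxx. Qed.

Let dist_spec x y :
  ball adj (dist x y) x y /\ forall m, ball adj m x y -> dist x y <= m.
Proof.
rewrite /dist; case: xgetP => [n _ [] //| nex].
have [_ _ /(_ x y) [p pp lp] _] := tr.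
have ex : exists n, `[< ball adj n x y >].
  by exists (size p); apply/asboolP; exists p.
case: (ex_minnP ex) => n /asboolP bn minn; case: (nex n); split=> // m bm.
exact/minn/asboolP.
Qed.

Lemma ballE n x y : ball adj n x y <-> dist x y <= n.
Proof.
split=> [|dn]; first by case: (dist_spec x y) => _; exact.
case: (dist_spec x y) => -[p [pp lp sp]] _; exists p; split=> //.
exact: leq_trans sp dn.
Qed.

Lemma distxx x : dist x x = 0.
Proof. by apply/eqP; rewrite -leqn0; apply/ballE; exists [::]. Qed.

Lemma dist_eq0 x y : (dist x y == 0) = (x == y).
Proof.
apply/idP/eqP => [|->]; last by rewrite distxx.
by rewrite -leqn0 => /ballE [p [_ <- sp]]; case: p sp.
Qed.

Lemma dist_triangle x y z : dist x z <= dist x y + dist y z.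
Proof.
have /ballE [p [pp lp sp]] := leqnn (dist x y).
have /ballE [q [pq lq sq]] := leqnn (dist y z).
apply/ballE; exists (p ++ q).
by rewrite cat_path last_cat lp pp pq lq size_cat leq_add.
Qed.

Lemma distC x y : dist x y = dist y x.
Proof.
suff le u v : dist u v <= dist v u by apply/eqP; rewrite eqn_leq !le.
have /ballE [p [pp lp sp]] := leqnn (dist v u).
apply/ballE; exists (rev (belast v p)); split; last by rewrite size_rev size_belast.
- by rewrite -lp rev_path; apply: sub_path pp => a b; rewrite /= adjC.
- by case: p {pp sp} lp => [|a p] //= _; rewrite rev_cons last_rcons.
Qed.

Lemma dist_adj x y : adj x y -> dist x y = 1.
Proof.
move=> xy; apply/eqP; rewrite eqn_leq; apply/andP; split.
  by apply/ballE; exists [:: y]; rewrite /= xy.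
by rewrite lt0n dist_eq0 adj_neq.
Qed.

Lemma dist1_adj x y : dist x y = 1 -> adj x y.
Proof.
move=> d1; have /ballE [[|a [|b p]] [/= pp lp sp]] //: dist x y <= 1 by rewrite d1.
- by move: d1; rewrite lp distxx.
- by move: pp; rewrite lp andbT.
Qed.

Lemma dist_adj_le o x y : adj x y -> dist o y <= (dist o x).+1.
Proof. by move=> /dist_adj xy; rewrite -addn1 -xy dist_triangle. Qed.

Lemma closer_nb o x : x != o ->
  exists2 u, adj x u & dist o x = (dist o u).+1.
Proof.
move=> xo; have /ballE [[|u p] [/= pp lp sp]] := leqnn (dist x o).
  by rewrite lp eqxx in xo.
have /andP[xu pu] := pp; exists u => //.
apply/eqP; rewrite eqn_leq [X in _ && X](_ : _ = true).
  by rewrite andbT; apply: dist_adj_le; rewrite adjC.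
rewrite (distC o x); apply: leq_trans sp; rewrite ltnS distC.
by apply/ballE; exists p.
Qed.

(* Otherwise the geodesics from [u] and [v] to [o], which avoid [x], close up
   to a cycle through [x]. *)
Lemma closer_nb_unique o x u v :
  adj x u -> adj x v -> dist o u <= dist o x -> dist o v <= dist o x -> u = v.
Proof.
have geod w : adj x w -> dist o w <= dist o x ->
    exists p, [/\ path adj w p, last w p = o & x \notin w :: p].
  move=> xw lew; have /ballE [p [pp lp sp]] := leqnn (dist w o).
  exists p; split=> //; apply/negP => xp.
  have {xp} xp : x \in p.
    by move: xp; rewrite inE => /orP[/eqP xE|//]; move: xw; rewrite -xE adjxx.
  move: pp lp sp; case/splitPr: xp => p1 p2.
  rewrite cat_path last_cat size_cat /= => /and3P[_ _ p2p] lp2 sp.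
  have : dist x o <= size p2 by apply/ballE; exists p2.
  rewrite (distC x o); rewrite distC in sp => dx.
  by have := leq_trans sp (leq_trans lew dx); rewrite addnS ltnNge leq_addl.
move=> xu xv lu lv; apply/eqP; apply: contraT => uv.
have [p [pp lp xp]] := geod _ xu lu.
have [q [pq lq xq]] := geod _ xv lv.
have pr : path adj u (p ++ rev (belast v q)).
  rewrite cat_path pp lp -lq rev_path.
  by apply: sub_path pq => a b; rewrite /= adjC.
have lr : last u (p ++ rev (belast v q)) = v.
  rewrite last_cat lp; case: q {pq xq pr} lq => [|a q] //=.
  by rewrite rev_cons last_rcons.
have xr : x \notin u :: p ++ rev (belast v q).
  move: xp xq; rewrite !inE mem_cat mem_rev !negb_or => /andP[-> ->] /=.
  move=> /andP[nxv nxq]; apply: contra nxq => xb; move: (mem_belast xb).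
  by rewrite inE (negPf nxv).
case: (shortenP pr) lr => s ps us sub lr.
have xs : x \notin u :: s.
  apply: contra xr; rewrite !inE => /orP[->//|/sub ->]; exact: orbT.
have [_ _ _ acyc] := tr.
have : size (x :: u :: s) <= 2.
  by apply: acyc; rewrite /ucycle /= rcons_path xu ps lr adjC xv /= xs.
by case: s lr {ps us sub xs} => //= uE; rewrite uE eqxx in uv.
Qed.

Lemma dist_adj_neq o x y : adj x y -> dist o y <> dist o x.
Proof.
move=> xy dE; case: (eqVneq x o) => [xo|xo].
  by move: dE; rewrite xo distxx => /eqP; rewrite dist_eq0 -xo (negPf (adj_neq xy)).
have [u xu uE] := closer_nb xo.
have uy : u = y by apply: (closer_nb_unique (o := o) xu xy); rewrite ?dE ?uE.
by move: uE; rewrite uy dE => /esym /eqP; rewrite eqn_leq ltnn.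
Qed.

Lemma dist_adj_cases o x y : adj x y ->
  dist o y = (dist o x).+1 \/ dist o x = (dist o y).+1.
Proof.
move=> xy; have := dist_adj_le o xy; rewrite adjC in xy.
have := dist_adj_le o xy; have := dist_adj_neq (o := o) xy; lia.
Qed.

Variable k : nat.
Hypothesis hreg : forall x, neighbors adj x #= `I_k.

Let nb_spec x : uniq (nb x) /\ forall y, (y \in nb x) = adj x y.
Proof.
rewrite /nb; case: xgetP => [s _ [] //| nex].
have /card_eq_seq [s [us _ sE]] := hreg x.
by case: (nex s); split=> // y; rewrite sE; apply/asboolP/idP.
Qed.

Lemma nb_uniq x : uniq (nb x).
Proof. by case: (nb_spec x). Qed.

Lemma mem_nb x y : (y \in nb x) = adj x y.
Proof. by case: (nb_spec x). Qed.

Lemma size_nb x : size (nb x) = k.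
Proof.
have /card_eq_seq [s [us <- sE]] := hreg x.
apply/perm_size/uniq_perm => //; first exact: nb_uniq.
by move=> y; rewrite mem_nb sE; apply/idP/asboolP.
Qed.

Definition par (o x : V) : V :=
  xget x [set u | adj x u /\ dist o x = (dist o u).+1].

Lemma parP o x : x != o -> adj x (par o x) /\ dist o x = (dist o (par o x)).+1.
Proof.
move=> xo; rewrite /par; case: xgetP => // nex.
by have [u xu uE] := closer_nb xo; case: (nex u).
Qed.

Lemma parE o x u : adj x u -> dist o x = (dist o u).+1 -> par o x = u.
Proof.
move=> xu uE; have [|xp pE] := parP (o := o) (x := x).
  by apply/eqP => xo; move: uE; rewrite xo distxx.
by apply: (closer_nb_unique (o := o) xp xu); [rewrite pE | rewrite uE].
Qed.

Lemma par_root o : par o o = o.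
Proof.
by rewrite /par; case: xgetP => // u _ [_]; rewrite distxx.
Qed.

(* At the root nothing is removed: [par o o = o] is not a neighbor of [o]. *)
Definition children (o x : V) : seq V := rem (par o x) (nb x).

Lemma mem_children o x y :
  (y \in children o x) = adj x y && (dist o y == (dist o x).+1).
Proof.
rewrite mem_rem_uniq ?nb_uniq // !inE mem_nb andbC; case xy: (adj x y) => //=.
apply/idP/eqP => [ypx | yE].
  case: (dist_adj_cases o xy) => // xE.
  by rewrite (parE xy xE) eqxx in ypx.
apply/eqP => yp; have [xo|xo] := eqVneq x o.
  by move: xy; rewrite yp xo par_root adjxx.
by have [_] := parP xo; rewrite -yp yE; lia.
Qed.

Lemma children_uniq o x : uniq (children o x).
Proof. exact/rem_uniq/nb_uniq. Qed.

Lemma childrenP o x y : reflect (y != o /\ par o y = x) (y \in children o x).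
Proof.
rewrite mem_children; apply: (iffP andP) => [[xy /eqP yE] | [yo <-]].
  split; last by apply: parE; rewrite // adjC.
  by apply/eqP => yo; move: yE; rewrite yo distxx.
by have [yp ->] := parP yo; rewrite adjC.
Qed.

(* A vertex at distance [i] from [x] and its image under the automorphism
   will have the same rank for [r i]. *)
Section Extension.
Variables (U : eqType) (r : nat -> V -> U) (x y : V).
Hypothesis r_nb : forall i u w, r i u = r i w ->
  perm_eq (map (r i.+1) (nb u)) (map (r i.+1) (nb w)).
Hypothesis r_mono : forall i u w, r i u = r i w -> r i.+2 u = r i.+2 w.
Hypothesis r_root : r 0 x = r 0 y.

Let matching i (s s' : seq V) : seq V :=
  xget [::] [set s'' | perm_eq s'' s' /\ map (r i) s'' = map (r i) s].

(** The first component is the image of [z], the second that of its parent. The latter has to be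
    removed from the neighbors of the former before the children are matched; at the root, removing
    [y] from its own neighbors changes nothing. *)
Fixpoint ext_images n (z : V) : V * V :=
  if n is m.+1 then
    let u := par x z in
    let w := ext_images m u in
    (nth w.1 (matching n (children x u) (rem w.2 (nb w.1)))
       (index z (children x u)), w.1)
  else (y, y).

Let g z := (ext_images (dist x z) z).1.
Let gpar z := (ext_images (dist x z) z).2.
Let targets u := matching (dist x u).+1 (children x u) (children y (g u)).

Let gpar_par z : z != x -> gpar z = g (par x z).
Proof. by move=> zx; rewrite /gpar (parP zx).2. Qed.

Let targetsP u : dist y (g u) = dist x u ->
  r (dist x u) u = r (dist x u) (g u) ->
  (u != x -> r (dist x u).-1 (par x u) = r (dist x u).-1 (par y (g u))) ->
  perm_eq (targets u) (children y (g u)) /\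
  map (r (dist x u).+1) (targets u) = map (r (dist x u).+1) (children x u).
Proof.
move=> dE rE rpE; rewrite /targets /matching; case: xgetP => // nex.
have /perm_map_lift [s []] : perm_eq (map (r (dist x u).+1) (children x u))
    (map (r (dist x u).+1) (children y (g u))); last by move=> sp sm; case: (nex s).
have pE := r_nb rE; have [ux|ux] := eqVneq u x.
  have guy : g u = y by apply/eqP; rewrite eq_sym -dist_eq0 dE ux distxx.
  have [pu pgu] : par x u = u /\ par y (g u) = g u by rewrite guy ux !par_root.
  by rewrite /children pu pgu !rem_id // mem_nb adjxx.
have [up uE] := parP ux; have guy : g u != y.
  by rewrite eq_sym -dist_eq0 dE uE.
have [gup _] := parP guy.
apply: perm_map_rem => //; rewrite ?mem_nb //.
(* The parents agree in the rank for distance [dist x u - 1], but are removed from lists of ranks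
   for distance [dist x u + 1]; hence the shift by two in [r_mono]. *)
by move: (rpE ux); rewrite uE /= => /r_mono.
Qed.

Let g_child z : z != x -> gpar (par x z) = par y (g (par x z)) ->
  g z = nth (g (par x z)) (targets (par x z)) (index z (children x (par x z))).
Proof. by move=> zx gE; rewrite {1}/g (parP zx).2 /= -/(g _) -/(gpar _) gE. Qed.

Let g_spec n z : dist x z = n -> [/\ dist y (g z) = n, r n z = r n (g z)
  & z != x -> par y (g z) = g (par x z)].
Proof.
have gpE u : (u != x -> par y (g u) = g (par x u)) -> gpar u = par y (g u).
  have [-> _|ux /(_ isT) ->] := eqVneq u x; last exact: gpar_par.
  by rewrite /gpar /g distxx par_root.
elim/ltn_ind: n z => -[|n] IH z zE.
  have -> : z = x by apply/eqP; rewrite eq_sym -dist_eq0 zE.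
  by rewrite /g !distxx /= eqxx.
have zx : z != x by rewrite eq_sym -dist_eq0 zE.
have [zp zE'] := parP zx; set u := par x z in zp zE' *.
have uE : dist x u = n by lia.
have [du ru pu] := IH n (ltnSn n) u uE.
have [||uxr|pL mL] := targetsP (u := u); rewrite ?uE //.
  have [_ uE'] := parP uxr; have nE : dist x (par x u) = n.-1 by lia.
  have [|_ rp _] := IH n.-1 _ _ nE; first by lia.
  by rewrite (pu uxr) rp.
have zc : z \in children x u by apply/childrenP.
rewrite uE in mL; rewrite (g_child zx) -/u; last exact: gpE.
have sE : size (targets u) = size (children x u).
  by have := congr1 size mL; rewrite !size_map.
have : nth (g u) (targets u) (index z (children x u)) \in children y (g u).
  by rewrite -(perm_mem pL) mem_nth // sE index_mem.
set w := nth _ _ _; rewrite mem_children => /andP[uw /eqP wE].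
split; first by rewrite wE du.
- rewrite -[in LHS](nth_index (g u) zc).
  rewrite -!(nth_map _ (r n.+1 (g u)) (r n.+1)) ?sE ?index_mem //.
  by rewrite mL (nth_map (g u)) // index_mem.
- by move=> _; apply: parE; rewrite // adjC.
Qed.

Let g_dist z : dist y (g z) = dist x z.
Proof. by have [] := g_spec (erefl (dist x z)). Qed.

Let g_par z : z != x -> par y (g z) = g (par x z).
Proof. by have [] := g_spec (erefl (dist x z)). Qed.

Let g_rank z : r (dist x z) (g z) = r (dist x z) z.
Proof. by have [] := g_spec (erefl (dist x z)). Qed.

Let g_root : g x = y.
Proof. by rewrite /g distxx. Qed.

Let g_targets u : perm_eq (targets u) (children y (g u)) /\
  size (targets u) = size (children x u).
Proof.
have [||ux|pL mL] := targetsP (u := u); rewrite ?g_dist ?g_rank //.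
  by have [_ ->] := parP ux; rewrite g_par //= g_rank.
by split=> //; have := congr1 size mL; rewrite !size_map.
Qed.

Let g_childE u z : z \in children x u ->
  g z = nth (g u) (targets u) (index z (children x u)).
Proof.
move=> /childrenP [zx zu]; rewrite -zu -g_child ?zu //.
have [->|ux] := eqVneq u x; last by rewrite gpar_par // g_par.
by rewrite /gpar g_root distxx /= par_root.
Qed.

Let g_inj : injective g.
Proof.
suff inj n z z' : dist x z = n -> g z = g z' -> z = z'.
  by move=> z z'; apply: inj.
elim: n z z' => [|n IH] z z' zE gE.
  have [] : z = x /\ z' = x; last by move=> -> ->.
  by split; apply/eqP; rewrite eq_sym -dist_eq0 -g_dist -?gE g_dist zE.
have zx : z != x by rewrite eq_sym -dist_eq0 zE.
have z'x : z' != x by rewrite eq_sym -dist_eq0 -g_dist -gE g_dist zE.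
have pE : par x z = par x z'.
  apply: IH; last by rewrite -!g_par // gE.
  by have [_] := parP zx; rewrite zE => -[].
have zc : z \in children x (par x z) by apply/childrenP.
have z'c : z' \in children x (par x z) by apply/childrenP.
have [pL sE] := g_targets (par x z).
move/eqP: gE; rewrite (g_childE zc) (g_childE z'c) nth_uniq ?sE ?index_mem //.
  by move/eqP/(congr1 (nth z (children x (par x z)))); rewrite !nth_index.
by rewrite (perm_uniq pL) children_uniq.
Qed.

Let g_surj w : exists z, g z = w.
Proof.
elim: {w}_.+1 {-2}w (ltnSn (dist y w)) => // n IH w wn.
have [->|wy] := eqVneq w y; first by exists x.
have [wp wE] := parP wy; have [|u uE] := IH (par y w); first by lia.
have [pL sE] := g_targets u.
have wc : w \in targets u by rewrite (perm_mem pL); apply/childrenP.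
have ilt : index w (targets u) < size (children x u) by rewrite -sE index_mem.
exists (nth u (children x u) (index w (targets u))).
by rewrite (g_childE (mem_nth _ _)) // index_uniq ?children_uniq // nth_index.
Qed.

(** The map is built outwards, matching the children of each vertex with those of its image
    according to rank. Letting the rank depend on the distance covers isomorphisms of finite balls,
    whose classes get coarser outwards, as well as automorphisms that preserve a fixed function. *)
Lemma automorphism_extension : exists g : V -> V,
  [/\ automorphism adj g, g x = y
    & forall z, r (dist x z) (g z) = r (dist x z) z].
Proof.
exists g; split=> //; split.
  have [h hE] := choice g_surj.
  by exists h => // z; apply: g_inj; rewrite hE.
have g_adj u v : adj u v -> adj (g u) (g v).
  have half a b : adj a b -> dist x b = (dist x a).+1 -> adj (g a) (g b).
    move=> ab bE; have bx : b != x by rewrite eq_sym -dist_eq0 bE.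
    have <- : par x b = a by apply: parE; rewrite // adjC.
    rewrite -g_par // adjC //; apply: (parP _).1.
    by rewrite eq_sym -dist_eq0 g_dist bE.
  move=> uv; have [/half|/half] := dist_adj_cases x uv; first exact.
  by rewrite [adj u v]adjC // [adj (g u) _]adjC // in uv *; apply.
have g_adj' u v : dist x v = (dist x u).+1 -> adj (g u) (g v) -> adj u v.
  move=> vE guv; have vx : v != x by rewrite eq_sym -dist_eq0 vE.
  have -> : u = par x v.
    apply: g_inj; rewrite -g_par //; apply/esym/parE; first by rewrite adjC.
    by rewrite !g_dist.
  by rewrite adjC //; apply: (parP vx).1.
move=> u v; apply/idP/idP => [guv|/g_adj //].
have [] := dist_adj_cases y guv; rewrite !g_dist => /g_adj'; first exact.
by rewrite [adj u v]adjC // [adj (g u) _]adjC // in guv *; apply.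
Qed.

End Extension.

Lemma path_ball_map (f : V -> V) x p (n : nat) :
  (forall u v, dist x u <= n -> dist x v <= n -> adj u v -> adj (f u) (f v)) ->
  path adj x p -> size p <= n -> path adj (f x) (map f p).
Proof.
move=> fadj; have : forall y, path adj y p -> dist x y + size p <= n ->
    path adj (f y) (map f p).
  elim: p => //= a p IH y /andP[ya pa] yn.
  have := dist_adj_le x ya => xa.
  by rewrite fadj ?IH //; lia.
by move=> H pp sp; apply: H; rewrite ?distxx.
Qed.

Lemma dist_ball_map (f : V -> V) x (n : nat) u :
  (forall u v, dist x u <= n -> dist x v <= n -> adj u v -> adj (f u) (f v)) ->
  dist x u <= n -> dist (f x) (f u) <= dist x u.
Proof.
move=> fadj un; have /ballE [p [pp lp sp]] := leqnn (dist x u).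
apply/ballE; exists (map f p); rewrite size_map last_map lp; split=> //.
by apply: path_ball_map fadj pp _; apply: leq_trans sp un.
Qed.

Lemma automorphism_dist (g : V -> V) x y :
  automorphism adj g -> dist (g x) (g y) = dist x y.
Proof.
move=> [[h gK hK] gadj]; apply/eqP; rewrite eqn_leq; apply/andP; split.
  by apply: (dist_ball_map (n := dist x y)) => // u v _ _; rewrite gadj.
rewrite -{1}(gK x) -{1}(gK y).
apply: (dist_ball_map (n := dist (g x) (g y))) => // u v _ _.
by rewrite -[adj (h u) _]gadj !hK.
Qed.

Hypothesis hk : 2 <= k.

Lemma exists_child o x : exists y, y \in children o x.
Proof.
have : 0 < size (children o x).
  rewrite /children; have [px|npx] := boolP (par o x \in nb x).
    by rewrite size_rem // size_nb; lia.
  by rewrite rem_id // size_nb; lia.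
by case: (children o x) => // y s _; exists y; rewrite inE eqxx.
Qed.

Lemma exists_descendant o x n :
  exists y, dist o y = dist o x + n /\ dist x y = n.
Proof.
elim: n => [|n [y [oy xy]]]; first by exists x; rewrite addn0 distxx.
have [z] := exists_child o y; rewrite mem_children => /andP[yz /eqP oz].
exists z; split; first by rewrite oz oy addnS.
have := dist_triangle o x z; have := dist_adj_le x yz; lia.
Qed.

(* The geodesic from [o] to [y] passes through [z]. *)
Definition branch (o z y : V) : Prop := dist o y = dist o z + dist z y.

Lemma branch_refl o z : branch o z z.
Proof. by rewrite /branch distxx addn0. Qed.

Lemma branch_trans o x z y : branch o x z -> branch o z y -> branch o x y.
Proof.
rewrite /branch => xz zy; have := dist_triangle o x y.
by have := dist_triangle x z y; lia.
Qed.

Lemma branch_dist o x z y : branch o x z -> branch o z y ->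
  dist x y = dist x z + dist z y.
Proof.
by move=> xz zy; have := branch_trans xz zy; move: xz zy; rewrite /branch; lia.
Qed.

Lemma branch_child o x y : y \in children o x -> branch o x y.
Proof.
by rewrite mem_children => /andP[xy /eqP yE]; rewrite /branch yE (dist_adj xy) addn1.
Qed.

(** If [b] were not [z], its neighbor towards [z] would also be the one towards [o]; any other
    neighbor is farther from both, so every neighbor of [b] would lie in the branch. *)
Lemma branch_enter o z a b : adj a b -> ~ branch o z a -> branch o z b -> b = z.
Proof.
move=> ab za zb; apply/eqP; apply: contraT => bz; case: za.
have [bw wE] := parP bz; set w := par z b in bw wE; rewrite /branch in zb *.
have := dist_triangle o z w => ow; have := dist_adj_le o bw => ow1.
rewrite adjC in ab; have := dist_adj_cases o ab; have := dist_adj_cases z ab.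
have [->|aw] := eqVneq a w.
  rewrite adjC in bw; have := dist_adj_le o bw; lia.
have upz : ~ dist z a <= dist z b.
  move=> le_ab; move/eqP: aw; apply; apply: closer_nb_unique ab bw le_ab _; lia.
have upo : ~ dist o a <= dist o b.
  move=> le_ab; move/eqP: aw; apply; apply: closer_nb_unique ab bw le_ab _; lia.
lia.
Qed.

Lemma branch_path o z x p : path adj x p -> ~ branch o z x ->
  branch o z (last x p) -> z \in p.
Proof.
elim: p x => [|a p IH] x //= /andP[xa pa] zx zl; rewrite inE.
have [za|za] := pselect (branch o z a).
  by rewrite (branch_enter xa zx za) eqxx.
by rewrite (IH a) // orbT.
Qed.

Lemma branch_gate o z x y : ~ branch o z x -> branch o z y ->
  dist x y = dist x z + dist z y.
Proof.
move=> zx zy; have /ballE [p [pp lp sp]] := leqnn (dist x y).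
rewrite -lp in zy; have := branch_path pp zx zy.
move=> /splitPr zp; case: zp pp lp sp {zy} => p1 p2.
rewrite cat_path last_cat size_cat /= => /and3P[pp1 lz pp2] lp2 sp.
have h1 : dist x z <= (size p1).+1.
  apply/ballE; exists (rcons p1 z).
  by rewrite rcons_path pp1 lz last_rcons size_rcons.
have h2 : dist z y <= size p2 by apply/ballE; exists p2.
have h3 := dist_triangle x z y.
move: h1 h2 h3 sp; move: (dist x z) (dist z y) (dist x y) (size p1) (size p2).
by clear; lia.
Qed.

(** The branch can be left only through [z], and one further step is needed to get out; hence radius
    [dist z x] is still allowed. *)
Lemma branch_ball o z x n u : branch o z x -> n <= dist z x -> dist x u <= n ->
  branch o z u.
Proof.
move=> zx nzx xu; apply: contrapT => zu; have := branch_gate zu zx.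
have : z <> u by move=> zuE; apply: zu; rewrite -zuE; apply: branch_refl.
move=> /eqP; rewrite -dist_eq0 (distC z u) (distC u x); lia.
Qed.

Lemma branch_par o x y c : y \in children o x -> ~ branch o y c ->
  dist y c = (dist x c).+1.
Proof.
move=> /childrenP [yo px] yc; have [xy yE] := parP yo; rewrite px in xy yE.
rewrite !(distC _ c); have [xcE|//] := dist_adj_cases c xy.
have cy : y != c by apply/eqP => yc'; apply: yc; rewrite yc'; apply: branch_refl.
have [yw wE] := parP cy; have [wx|nwx] := pselect (branch o y (par c y)).
  by have := branch_gate yc wx; lia.
have : par c y = x.
  have [wE'|wE'] := dist_adj_cases o yw; last by rewrite -(parE yw wE').
  case: nwx; apply: branch_child; rewrite mem_children yw; exact/eqP.
by move=> <-.
Qed.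

Lemma branch_bounded o (K : set V) : finite_set K ->
  exists n, forall z y, n < dist o z -> branch o z y -> ~ K y.
Proof.
move=> /finite_seqP [s ->]; exists (\max_(y <- s) dist o y) => z y zn zy /= ys.
by move: zn; rewrite (big_rem y ys) /= /branch in zy *; lia.
Qed.

(** * Subtrees along a leafless set of vertices *)

Section Dichotomy.
Variables (o : V) (W : V -> Prop).
Hypothesis W_child : forall w, W w -> exists2 w', w' \in children o w & W w'.

Lemma branch_within x n : W x -> exists z, [/\ W z, branch o x z & dist x z = n].
Proof.
move=> Wx; elim: n => [|n [z [Wz xz zn]]].
  by exists x; rewrite distxx; split=> //; apply: branch_refl.
have [w wz Ww] := W_child Wz; have zw := branch_child wz.
exists w; split=> //; first exact: branch_trans xz zw.
move: wz; rewrite mem_children => /andP[wz _].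
by rewrite (branch_dist xz zw) zn (dist_adj wz) addn1.
Qed.

(** Once below a point [y0] of [S], a vertex [z1] missing from [S] cuts off its whole branch: a path
    in [S] from [y0] into that branch would pass through [z1]. The vertex [z] is taken deeper than
    [y0] so that no branch below it contains [y0]. *)
Lemma subtree_dichotomy x (S : set V) : W x -> subtree adj S ->
  exists z, [/\ W z, branch o x z &
    (forall y, W y -> branch o z y -> S y) \/ (forall y, branch o z y -> ~ S y)].
Proof.
move=> Wx [_ Sconn].
have [[y0 [Sy0 xy0]]|nS] := pselect (exists y, S y /\ branch o x y); last first.
  exists x; split=> //; first exact: branch_refl.
  by right=> y xy Sy; apply: nS; exists y.
have [z [Wz xz zn]] := branch_within (dist o y0).+1 Wx.
have [SW|nSW] := pselect (forall y, W y -> branch o z y -> S y).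
  by exists z; split=> //; left.
have [z1 [Wz1 zz1 nSz1]] : exists z1, [/\ W z1, branch o z z1 & ~ S z1].
  apply: contrapT => nex; apply: nSW => y Wy zy; apply: contrapT => nSy.
  by apply: nex; exists y.
exists z1; split=> //; first exact: branch_trans xz zz1.
right=> y z1y Sy; have [p [pp lp Sp]] := Sconn _ _ Sy0 Sy.
apply/nSz1/Sp/(branch_path pp (o := o)); last by rewrite lp.
by move: xz zz1; rewrite /branch; lia.
Qed.

Lemma subtrees_dichotomy x m (S : 'I_m -> set V) :
  W x -> (forall i, subtree adj (S i)) ->
  exists z, [/\ W z, branch o x z & forall i,
    (forall y, W y -> branch o z y -> S i y) \/ (forall y, branch o z y -> ~ S i y)].
Proof.
move=> Wx ST.
suff [z [Wz xz zS]] : exists z, [/\ W z, branch o x z & {in enum 'I_m, forall i,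
    (forall y, W y -> branch o z y -> S i y) \/ (forall y, branch o z y -> ~ S i y)}].
  by exists z; split=> // i; apply: zS; rewrite mem_enum.
elim: (enum 'I_m) => [|i s [z [Wz xz zS]]].
  by exists x; split=> //; apply: branch_refl.
have [z' [Wz' zz' z'S]] := subtree_dichotomy Wz (ST i).
exists z'; split=> //; first exact: branch_trans xz zz'.
move=> i'; rewrite inE => /orP[/eqP -> //|/zS [SW|nS]]; [left|right] => y.
  by move=> Wy z'y; apply: SW => //; apply: branch_trans zz' z'y.
by move=> z'y; apply: nS; apply: branch_trans zz' z'y.
Qed.

End Dichotomy.

(** [D] bounds the distances from [v] to one representative of each of the finitely many orbits; the
    group moves this bound everywhere. *)
Lemma cofinite_group_dist (G : set (V -> V)) v :
  automorphism_group adj G -> cofinite_group G ->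
  exists D, forall x, exists2 g, G g & dist x (g v) <= D.
Proof.
move=> [Gaut Gid Gcomp Ginv] /finite_seqP [s sE].
pose pick B := xget v [set x | orbit_of G x = B].
exists (\max_(B <- s) dist (pick B) v) => x.
have xs : orbit_of G x \in s.
  have : range (orbit_of G) (orbit_of G x) by exists x.
  by rewrite sE.
have : orbit_of G (pick (orbit_of G x)) = orbit_of G x.
  by rewrite /pick; case: xgetP => // nex; case: (nex x).
have : orbit_of G x x by exists id.
move=> /[swap] <- [g Gg gx]; exists g => //.
have := automorphism_dist (pick (orbit_of G x)) v (Gaut _ Gg).
by rewrite gx => ->; rewrite (big_rem _ xs) leq_maxl.
Qed.

(** * Horocyclic colorings *)

Section Ray.
Variables (P : nat) (r : nat -> V).
Hypotheses (P0 : 0 < P) (ray : forall n, r n.+1 \in children (r 0) (r n)).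

Let ray_dist n : dist (r 0) (r n) = n.
Proof.
elim: n => [|n IH]; first by rewrite distxx.
by have := ray n; rewrite mem_children IH => /andP[_ /eqP].
Qed.

Let ray_adj n : adj (r n) (r n.+1).
Proof. by have := ray n; rewrite mem_children => /andP[]. Qed.

Definition receding x n : Prop := dist x (r n.+1) = (dist x (r n)).+1.

(** Otherwise [r n] and [r n.+2] would both be the neighbor of [r n.+1] closer to [x]. *)
Lemma recedingS x n : receding x n -> receding x n.+1.
Proof.
rewrite /receding => rec; have [//|ap] := dist_adj_cases x (ray_adj n.+1).
have bk := ray_adj n; rewrite adjC in bk.
have : r n = r n.+2.
  by apply: (closer_nb_unique (o := x) bk (ray_adj n.+1)); lia.
by move=> /(congr1 (dist (r 0))); rewrite !ray_dist; lia.
Qed.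

Lemma receding_ge x m n : m <= n -> receding x m -> receding x n.
Proof.
move=> /subnK <- rec; elim: (n - m) => // d IH; rewrite addSn.
exact: recedingS.
Qed.

Lemma receding_dist x : receding x (dist x (r 0)).
Proof.
apply: contrapT => nrec.
have app n : n <= (dist x (r 0)).+1 -> dist x (r n) + n = dist x (r 0).
  elim: n => [|n IH] nx; first by rewrite addn0.
  have [rec|ap] := dist_adj_cases x (ray_adj n).
    by case: nrec; apply: receding_ge rec; lia.
  by have := IH (ltnW nx); lia.
by have := app _ (leqnn _); lia.
Qed.

(* The value modulo [P] of the Busemann function [dist x (r n) - n], for large
   [n]; the factor [P.-1] stands for [-1]. *)
Definition horo_at n x := (dist x (r n) + n * P.-1) %% P.

Definition horo x := horo_at (dist x (r 0)) x.

Lemma horo_at_ge x m n : m <= n -> receding x m -> horo_at n x = horo_at m x.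
Proof.
move=> mn rec; rewrite -(subnK mn); elim: (n - m) => // d IH.
rewrite -IH addSn /horo_at (receding_ge (leq_addl d m) rec).
rewrite (_ : _ + _ = dist x (r (d + m)) + (d + m) * P.-1 + P) ?modnDr //.
by rewrite mulSn; lia.
Qed.

Lemma horoE x n : receding x n -> horo x = horo_at n x.
Proof.
move=> rec; have [le|/ltnW le] := leqP n (dist x (r 0)).
  exact: horo_at_ge le rec.
exact/esym/(horo_at_ge le)/receding_dist.
Qed.

Lemma horo_lt x : horo x < P.
Proof. exact: ltn_pmod. Qed.

(** Exactly one neighbor is nearer to the end of the ray. The value at a vertex therefore determines
    the values around it, which is what [automorphism_extension] needs. *)
Lemma horo_nb x : perm_eq (map horo (nb x))
  ((horo x + P.-1) %% P :: nseq k.-1 ((horo x).+1 %% P)).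
Proof.
(* From this index on, [x] and all its neighbors recede, and [r n] is too far from [r 0] to be
   [x]. *)
pose n := (dist x (r 0)).+2; pose u := par (r n) x.
have xn : x != r n by rewrite -dist_eq0; have := dist_triangle (r 0) x (r n);
  rewrite ray_dist (distC (r 0)); lia.
have [xu uE] := parP xn; rewrite -/u in xu uE.
have hx : horo x = horo_at n x.
  by apply: horoE; apply: receding_ge (receding_dist x); rewrite /n; lia.
have hy y : adj x y -> horo y = horo_at n y.
  move=> xy; apply: horoE; apply: receding_ge (receding_dist y).
  by have := dist_adj_le (r 0) xy; rewrite !(distC (r 0)) /n; lia.
have un : u \in nb x by rewrite mem_nb.
apply: perm_trans (perm_map horo (perm_to_rem un)) _ => /=.
have -> : horo u = (horo x + P.-1) %% P.
  rewrite hx (hy u xu) /horo_at modnDml !(distC _ (r n)) uE.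
  by rewrite (_ : _ + P.-1 = dist (r n) u + n * P.-1 + P) ?modnDr //; lia.
rewrite perm_cons; have : all (pred1 ((horo x).+1 %% P)) (map horo (rem u (nb x))).
  apply/allP => _ /mapP [y + ->]; rewrite mem_rem_uniq ?nb_uniq // !inE mem_nb.
  move=> /andP[yu xy]; rewrite hx (hy y xy) /horo_at -[in X in _ == X]addn1 modnDml.
  have yE : dist (r n) y = (dist (r n) x).+1.
    by have [//|/(parE xy) yp] := dist_adj_cases (r n) xy; rewrite -yp eqxx in yu.
  by rewrite !(distC _ (r n)) yE; apply/eqP; congr (_ %% _); lia.
by move=> /all_pred1P ->; rewrite size_map size_rem // size_nb perm_refl.
Qed.

Lemma horo_transitive x y : horo x = horo y ->
  exists g, [/\ automorphism adj g, g x = y & forall z, horo (g z) = horo z].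
Proof.
move=> xy; have [||g [gaut gx gz]] :=
  automorphism_extension (r := fun=> horo) (x := x) (y := y) _ _ xy => //.
  move=> _ u w uw; rewrite (permPl (horo_nb u)) uw perm_sym.
  exact: horo_nb.
by exists g.
Qed.

(** The group consists of all automorphisms preserving [horo]; it is transitive on each of the at
    most [P] level sets. *)
Lemma horo_periodic (A : countType) (c : nat -> A) : periodic adj (c \o horo).
Proof.
exists [set g | automorphism adj g /\ forall z, horo (g z) = horo z]; split.
- split=> [g [] //||g h [[gb ga] gz] [[hb ha] hz]|g h [[gb ga] gz] gh hg].
  + by split=> //; split=> //; exists id.
  + split; last by move=> z; rewrite /= gz hz.
    by split; [apply: bij_comp | move=> u v; rewrite /= ga ha].
  + split; last by move=> z; rewrite -gz hg.
    by split; [exists g | move=> u v; rewrite -ga !hg].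
- apply: (sub_finite_set (B := (fun t => [set y | horo y = t]) @` `I_P)).
    move=> _ [x _ <-]; exists (horo x); first exact: horo_lt.
    apply/seteqP; split=> [y /= xy|_ [g [_ gz] <-] /=]; last exact: gz.
    by have [g [gaut gx gz]] := horo_transitive (esym xy); exists g.
  exact/finite_image/finite_II.
- by move=> g [_ gz] x /=; rewrite gz.
Qed.

End Ray.

Lemma exists_ray x y : adj x y -> exists r : nat -> V,
  [/\ r 0 = x, r 1 = y & forall n, r n.+1 \in children (r 0) (r n)].
Proof.
move=> xy; have [nx nxP] := choice (exists_child x).
exists (fun n => if n is m.+1 then iter m nx y else x); split=> // -[|n] /=.
  by rewrite mem_children xy distxx (dist_adj xy).
exact: nxP.
Qed.

(** * Colored balls as classes of a color refinement *)

Section Coloring.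
Variables (A : countType) (phi : V -> A).

(* [equiv n.+1 x y] says that the colored [n]-balls at [x] and [y] are
   isomorphic ([ball_isoP]). The shift makes [equiv 0] total, so that a Sturmian
   coloring has exactly [n.+1] classes at level [n], for all [n]. *)
Fixpoint equiv (n : nat) : rel V :=
  if n is m.+1 then
    let rep z := choose (equiv m z) z in
    fun x y => (phi x == phi y) && perm_eq (map rep (nb x)) (map rep (nb y))
  else fun _ _ => true.

Definition rep n x := choose (equiv n x) x.

Lemma equivS n x y : equiv n.+1 x y =
  (phi x == phi y) && perm_eq (map (rep n) (nb x)) (map (rep n) (nb y)).
Proof. by []. Qed.

Lemma equiv_refl n x : equiv n x x.
Proof. by case: n => // n; rewrite equivS eqxx perm_refl. Qed.

Lemma equiv_sym n x y : equiv n x y = equiv n y x.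
Proof. by case: n => // n; rewrite !equivS eq_sym perm_sym. Qed.

Lemma equiv_trans n y x z : equiv n x y -> equiv n y z -> equiv n x z.
Proof.
case: n => // n; rewrite !equivS => /andP[/eqP -> p] /andP[/eqP -> q].
by rewrite eqxx (perm_trans p q).
Qed.

Lemma equiv_transl n x y z : equiv n x y -> equiv n x z = equiv n y z.
Proof.
by move=> xy; apply/idP/idP; apply: equiv_trans; rewrite // equiv_sym.
Qed.

Lemma equiv_rep n x : equiv n x (rep n x).
Proof. exact: chooseP (equiv_refl n x). Qed.

Lemma repP n x y : reflect (rep n x = rep n y) (equiv n x y).
Proof.
apply: (iffP idP) => [xy | xy].
  rewrite /rep -(choose_id xy (equiv_refl n x)).
  by rewrite (eq_choose (Q := equiv n y)) // => z; apply: equiv_transl.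
apply: (equiv_trans (equiv_rep n x)).
by rewrite xy equiv_sym equiv_rep.
Qed.

Lemma equiv_pred n x y : equiv n.+1 x y -> equiv n x y.
Proof.
elim: n x y => // n IH x y; rewrite !equivS => /andP[-> /=].
have repE s : map (rep n) s = map (rep n) (map (rep n.+1) s).
  by rewrite -map_comp; apply: eq_map => z; apply/repP/IH/equiv_rep.
by rewrite (repE (nb x)) (repE (nb y)); apply: perm_map.
Qed.

Lemma equiv_le m n x y : m <= n -> equiv n x y -> equiv m x y.
Proof.
move=> /subnK <-; elim: (n - m) => // d IH; rewrite addSn => /equiv_pred.
exact: IH.
Qed.

Lemma equiv_phi n x y : equiv n.+1 x y -> phi x = phi y.
Proof. by rewrite equivS => /andP[/eqP]. Qed.

Lemma equiv_nb n x y u : equiv n.+1 x y -> adj x u ->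
  exists2 v, adj y v & equiv n u v.
Proof.
rewrite equivS => /andP[_ pE] xu.
have : rep n u \in map (rep n) (nb y).
  by rewrite -(perm_mem pE) map_f // mem_nb.
by case/mapP=> v; rewrite mem_nb => yv /repP uv; exists v.
Qed.

Lemma equiv_within n m x y z : (forall i, equiv i x y) -> dist x z <= m ->
  exists2 z', dist y z' <= m & equiv n z z'.
Proof.
move=> xy; elim: m n z => [|m IH] n z.
  rewrite leqn0 dist_eq0 => /eqP <-; exists y; first by rewrite distxx.
  exact: xy.
have [->|zx] := eqVneq z x.
  by exists y; [rewrite distxx | exact: xy].
have [zu zE] := parP zx; rewrite zE ltnS => /(IH n.+1) [w yw /equiv_nb].
rewrite [adj z _]adjC in zu => /(_ _ zu) [v wv zv]; exists v => //.
by have := dist_adj_le y wv; lia.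
Qed.

(* Adjacency only has to be preserved in one direction: since the degrees are
   finite and equal, an injective map on neighbors is bijective. *)
Lemma ball_map_equiv n x (f : V -> V) :
  (forall u v, dist x u <= n -> dist x v <= n -> adj u v -> adj (f u) (f v)) ->
  (forall u v, dist x u <= n -> dist x v <= n -> f u = f v -> u = v) ->
  (forall u, dist x u <= n -> phi (f u) = phi u) ->
  equiv n.+1 x (f x).
Proof.
elim: n x => [|n IH] x fadj finj fphi.
  rewrite equivS fphi ?distxx // eqxx /=.
  have cE s : map (rep 0) s = nseq (size s) (rep 0 x).
    by elim: s => //= a s ->; congr (_ :: _); apply/repP.
  by rewrite !cE !size_nb.
have near u : u \in nb x -> forall v, dist u v <= n -> dist x v <= n.+1.
  rewrite mem_nb => /dist_adj xu v uv.
  by apply: leq_trans (dist_triangle x u v) _; rewrite xu add1n ltnS.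
have near1 u : u \in nb x -> dist x u <= n.+1.
  by move=> xu; apply: near xu _ _; rewrite distxx.
rewrite equivS fphi ?distxx // eqxx /=.
have pf : perm_eq (map f (nb x)) (nb (f x)).
  have ux : uniq (map f (nb x)).
    by rewrite map_inj_in_uniq ?nb_uniq // => u v /near1 un /near1 vn; apply: finj.
  have [||sE mE] := uniq_min_size (s2 := nb (f x)) ux.
  - move=> _ /mapP [u xu ->]; rewrite mem_nb fadj ?distxx ?near1 //.
    by rewrite -mem_nb.
  - by rewrite size_map !size_nb.
  - exact: uniq_perm ux (nb_uniq _) mE.
rewrite -(permPr (perm_map (rep n.+1) pf)) -map_comp.
rewrite (_ : map _ (nb x) = map (rep n.+1 \o f) (nb x)) ?perm_refl //.
apply/eq_in_map => u xu /=.
apply/repP; apply: IH => [v w un wn|v w un wn|v vn].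
- by apply: fadj; apply: (near u).
- by apply: finj; apply: (near u).
- by apply: fphi; apply: (near u).
Qed.

Lemma automorphism_equiv n x (g : V -> V) : automorphism adj g ->
  (forall u, dist x u <= n -> phi (g u) = phi u) -> equiv n.+1 x (g x).
Proof.
move=> [[h gK _] gadj] gphi; apply: ball_map_equiv => // u v _ _.
  by rewrite gadj.
exact: can_inj gK _ _.
Qed.

Lemma equiv_ball_iso n x y : equiv n.+1 x y -> ball_iso adj phi n x y.
Proof.
(* At distance [i] from the center only level [n.+1 - i] has to agree. Beyond radius [n] the rank is
   trivial, so the isomorphism is found as the restriction of an automorphism of the whole tree. *)
move=> xy; have [|||g [gaut gx gE]] :=
  automorphism_extension (r := fun i => rep (n.+1 - i)) (x := x) (y := y).
- move=> i u w /repP uw; case: (ltnP i n.+1) => [|ni].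
    rewrite ltnS => i_n; move: uw; rewrite subSn // => /andP[_].
    by rewrite subSS.
  have -> : n.+1 - i.+1 = 0 by lia.
  have cE s : map (rep 0) s = nseq (size s) (rep 0 x).
    by elim: s => //= a s ->; congr (_ :: _); apply/repP.
  by rewrite !cE !size_nb.
- by move=> i u w /repP uw; apply/repP; apply: equiv_le uw; lia.
- by apply/repP; rewrite subn0.
- exists g; split.
  + have [[h gK hK] gadj] := gaut; split.
    * by move=> u /ballE xu; apply/ballE; rewrite -gx automorphism_dist.
    * by move=> u v _ _; apply: can_inj gK _ _.
    * move=> w /ballE yw; exists (h w); last exact: hK.
      by apply/ballE; rewrite -(automorphism_dist _ _ gaut) gx hK.
  + by move=> u v _ _; rewrite gaut.2.
  + move=> u /ballE xu; have /repP := gE u.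
    by rewrite subSn // => /equiv_phi.
Qed.

Lemma ball_iso_equiv n x y : ball_iso adj phi n x y -> equiv n.+1 x y.
Proof.
move=> [f [[ffun finj fsurj] fadj fphi]].
have fadj' u v : dist x u <= n -> dist x v <= n -> adj u v -> adj (f u) (f v).
  by move=> /ballE xu /ballE xv; rewrite fadj.
(* Otherwise some vertex at distance [n] from [y], in the direction away from [f x], would be more
   than [n] away from [f x], whereas [f] does not increase distances from the center. *)
have <- : f x = y.
  have bx : ball adj n x x by apply/ballE; rewrite distxx.
  have /ballE yf := ffun x bx; apply/eqP; apply: contraT => fy.
  have n0 : 0 < n.
    case: n yf fy {ffun finj fsurj fadj fphi fadj' bx} => //.
    by rewrite leqn0 dist_eq0 eq_sym => ->.
  have [w [dw yw]] := exists_descendant (f x) y n.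
  have /fsurj [u /ballE xu uw] : ball adj n y w by apply/ballE; rewrite yw.
  have := dist_ball_map fadj' xu; rewrite uw dw.
  have : 0 < dist (f x) y by rewrite lt0n dist_eq0.
  by lia.
apply: ball_map_equiv => //.
- move=> u v /ballE xu /ballE xv; apply: finj; exact: mem_set.
- by move=> u /ballE; apply: fphi.
Qed.

Lemma ball_isoP n x y : ball_iso adj phi n x y <-> equiv n.+1 x y.
Proof. by split; [apply: ball_iso_equiv | apply: equiv_ball_iso]. Qed.

(** * Splitting classes and levels *)

Hypothesis hsturmian : sturmian adj phi.

Definition split_at n x y := equiv n x y && ~~ equiv n.+1 x y.

(** Match the neighbors of [a] and [a'] by their level-[n] classes: if no matched pair were
    separated at level [n.+1], neither would [a] and [a'] be at level [n.+2]. *)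
Lemma split_nb n a a' : split_at n.+1 a a' ->
  exists z z', [/\ adj a z, adj a' z' & split_at n z z'].
Proof.
move=> /andP[aa']; rewrite equivS (equiv_phi aa') eqxx /= => nperm.
have := aa'; rewrite equivS => /andP[_ /perm_map_lift [s [ps sE]]].
apply: contrapT => nex; case/negP: nperm.
rewrite -(permPr (perm_map (rep n.+1) ps)).
rewrite (map_eq_transfer (g := rep n.+1) sE) ?perm_refl // => z' z.
rewrite (perm_mem ps) !mem_nb => a'z' az /repP zz'.
apply: contrapT => /repP nzz'; case: nex; exists z, z'; split=> //.
by rewrite /split_at equiv_sym zz' equiv_sym.
Qed.

Lemma colored_ballE n x y :
  colored_ball adj phi n x = colored_ball adj phi n y <-> equiv n.+1 x y.
Proof.
split=> [xy|xy].
  by apply/ball_isoP; rewrite -[ball_iso _ _ _ _ _]/(colored_ball adj phi n x y) xy;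
    apply/ball_isoP/equiv_refl.
apply/seteqP; split=> z /ball_isoP xz; apply/ball_isoP.
  by rewrite equiv_sym in xy; apply: equiv_trans xy xz.
exact: equiv_trans xy xz.
Qed.

(** The Sturmian hypothesis enters only through this count. At level 0 it merely provides a
    vertex. *)
Lemma rep_seq n : exists s : seq V,
  [/\ uniq s, size s = n.+1, forall x, rep n x \in s & {in s, forall x, rep n x = x}].
Proof.
have repK m x : rep m (rep m x) = rep m x by apply/esym/repP/equiv_rep.
case: n => [|n].
  have : range (colored_ball adj phi 0) #= `I_2 := hsturmian 0.
  move=> /card_eq_seq [s [_ s2 sE]]; case: s s2 sE => // B s _ sE.
  have := sE B; rewrite inE eqxx => /esym/asboolP [x _ _].
  exists [:: rep 0 x]; split=> // [y|y]; rewrite inE.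
    by apply/eqP/repP.
  by move=> /eqP ->.
have : range (rep n.+1) #= range (colored_ball adj phi n).
  apply/card_set_bijP; exists (colored_ball adj phi n); split.
  - by move=> x _; exists x.
  - move=> x y; rewrite !in_setE => -[x' _ <-] [y' _ <-] /colored_ballE.
    by move/repP; rewrite !repK.
  - move=> _ [x _ <-]; exists (rep n.+1 x); first by exists x.
    by apply/colored_ballE; rewrite equiv_sym equiv_rep.
move=> /card_eq_trans/(_ (hsturmian n))/card_eq_seq [s [us sn sE]].
exists s; split=> // [|x|x]; first by rewrite sn addn2.
  by rewrite sE; apply/asboolP; exists x.
by rewrite sE => /asboolP [y _ <-].
Qed.

(* The number of classes grows by one at each level, so exactly one class
   splits, and into exactly two. *)
Lemma split_unique n x x' y y' : split_at n x x' -> split_at n y y' ->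
  equiv n.+1 y x /\ equiv n.+1 y' x' \/ equiv n.+1 y x' /\ equiv n.+1 y' x.
Proof.
have [t [ut tn tm tr']] := rep_seq n; have [s [us sn sm sr]] := rep_seq n.+1.
have repE z : rep n (rep n.+1 z) = rep n z.
  by apply/esym/repP/equiv_pred/equiv_rep.
have neq z z' : split_at n z z' ->
    rep n.+1 z != rep n.+1 z' /\ rep n (rep n.+1 z) = rep n (rep n.+1 z').
  move=> /andP[zz' /negP nzz']; split; first by apply/eqP => /repP.
  by rewrite !repE; apply/repP.
move=> /neq [xx' fx] /neq [yy' fy].
have [||[]|[]] := collision_unique us ut _ _ (sm x) (sm x') (sm y) (sm y') xx' fx yy' fy.
- by rewrite sn tn.
- by move=> u /tr' <-; rewrite -repE map_f.
- by move=> /repP ? /repP ?; left.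
- by move=> /repP ? /repP ?; right.
Qed.

Lemma split_exists n : exists x y, split_at n x y.
Proof.
have [t [ut tn tm tr']] := rep_seq n; have [s [us sn sm sr]] := rep_seq n.+1.
apply: contrapT => nex; suff : size (map (rep n) s) <= size t.
  by rewrite size_map sn tn ltnn.
apply: uniq_leq_size => [|u /mapP [z _ ->] //].
rewrite map_inj_in_uniq // => x y xs ys /repP xy.
rewrite -(sr x xs) -(sr y ys); apply/repP; apply: contrapT => /negP nxy.
by apply: nex; exists x, y; rewrite /split_at xy.
Qed.

Lemma type_setP n x :
  type_set adj phi x n <-> exists y, split_at n.+1 x y.
Proof.
split=> [[a [b [/colored_ballE ax /colored_ballE bx ab]]] | [y /andP[xy /negP nxy]]].
  have {}ab : ~~ equiv n.+2 a b by apply/negP => /colored_ballE.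
  have [xa|xa] := boolP (equiv n.+2 x a).
    exists b; rewrite /split_at equiv_sym bx; apply: contra ab => xb.
    by rewrite equiv_sym in xa; apply: equiv_trans xa xb.
  by exists a; rewrite /split_at equiv_sym ax xa.
exists x, y; split=> //; last by move/colored_ballE.
by apply/colored_ballE; rewrite equiv_sym.
Qed.

Definition final n x := forall y, equiv n x y -> forall m, equiv m x y.

Lemma finalP n x : (forall m y, n <= m -> ~~ split_at m x y) -> final n x.
Proof.
move=> nsplit y xy m; case: (leqP m n) => [/equiv_le|/ltnW/subnKC <-]; first exact.
elim: (m - n) => [|d IH]; first by rewrite addn0.
rewrite addnS; apply: contraT => nxy.
by have := nsplit (n + d) y (leq_addr _ _); rewrite /split_at IH nxy.
Qed.

Lemma final_split n m x y : final n x -> n <= m -> ~~ split_at m x y.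
Proof.
move=> fx nm; apply/negP => /andP[xy /negP]; apply.
exact/fx/(equiv_le nm).
Qed.

Lemma bounded_type_final : bounded_type adj phi -> exists n x, final n x.
Proof.
(* A type [m] is a splitting at level [m.+1], so the last one is over at the maximum plus 2. *)
move=> [x /finite_seqP [s sE]]; exists (\max_(i <- s) i).+2, x.
apply: finalP => -[//|m] y; rewrite ltnS => lt_m; apply/negP => xy.
have : type_set adj phi x m by apply/type_setP; exists y.
rewrite sE => /= ms; move: lt_m; rewrite ltnNge => /negP; apply.
by rewrite (big_rem m ms) leq_maxl.
Qed.

Lemma finite_ball x n : exists s : seq V, forall z, dist x z <= n -> z \in s.
Proof.
elim: n => [|n [s sE]].
  by exists [:: x] => z; rewrite leqn0 dist_eq0 inE eq_sym.
exists (s ++ flatten (map nb s)) => z; rewrite mem_cat.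
rewrite leq_eqVlt ltnS => /orP[/eqP zn|/sE ->//]; apply/orP; right.
have zx : z != x by rewrite eq_sym -dist_eq0 zn.
have [zu uE] := parP zx; apply/flattenP; exists (nb (par x z)).
  by rewrite map_f // sE; lia.
by rewrite mem_nb adjC.
Qed.

(* If [U], a union of level-[n] classes, contained the class that splits at
   level [n], then the class splitting at level [n + i] would lie in the
   [i]-neighborhood of [U]. Farther away no class would ever split again, so
   that finitely many neighborhoods of [U] would cover the tree. *)
Lemma no_split_inside (l : V -> nat) (J n : nat) (U : V -> Prop) :
  (forall x y, l x <= l y + dist x y) -> (forall j, exists x, j < l x) ->
  (forall x, U x -> l x <= J) -> (forall x y, U x -> equiv n x y -> U y) ->
  forall y y', U y -> ~~ split_at n y y'.
Proof.
move=> lip unb UJ Usat y y' Uy; apply/negP => syy'.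
pose W i x := exists u, U u /\ dist x u <= i.
have Wsat i x z : W i x -> equiv (n + i) x z -> W i z.
  elim: i x z => [|i IH] x z [u [Uu xu]] xz.
    move: xu xz; rewrite leqn0 dist_eq0 addn0 => /eqP -> xz.
    by exists z; rewrite distxx; split=> //; apply: Usat Uu xz.
  rewrite addnS in xz; have [xui|] := leqP (dist x u) i.
    have [|v [Uv zv]] := IH x z _ (equiv_pred xz); first by exists u.
    by exists v; split=> //; apply: leqW.
  move=> xui; have {xui xu} xu : dist u x = i.+1 by rewrite distC; lia.
  have xnu : x != u by rewrite eq_sym -dist_eq0 xu.
  have [xw wE] := parP xnu; have [v zv wv] := equiv_nb xz xw.
  have [|t [Ut vt]] := IH _ _ _ wv; first by exists u; rewrite distC; split=> //; lia.
  exists t; split=> //; have := dist_triangle z v t; rewrite (dist_adj zv).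
  by move=> /leq_trans; apply; rewrite add1n ltnS.
have Wsplit i a a' : split_at (n + i) a a' -> W i a.
  elim: i a a' => [|i IH] a a'.
    rewrite addn0 => saa'; exists a; rewrite distxx; split=> //.
    have /andP[yy' _] := syy'.
    have [[/equiv_pred ya _]|[/equiv_pred ya _]] := split_unique syy' saa'.
      by apply: Usat Uy _; rewrite equiv_sym.
    by apply: Usat Uy _; rewrite equiv_sym; apply: equiv_trans ya _; rewrite equiv_sym.
  rewrite addnS => /split_nb [z [z' [az _ /IH [u [Uu zu]]]]]; exists u; split=> //.
  have := dist_triangle a z u; rewrite (dist_adj az).
  by move=> /leq_trans; apply; rewrite add1n ltnS.
have Wout i x z : ~ W i x -> equiv n x z -> equiv (n + i) x z.
  elim: i => [|i IH] Wx xz; first by rewrite addn0.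
  have Wx' : ~ W i x by move=> [u [Uu xu]]; apply: Wx; exists u; split=> //; apply: leqW.
  rewrite addnS; apply: contraT => nxz; exfalso; apply: (Wx').
  apply: Wsplit (_ : split_at _ _ z).
  by rewrite /split_at IH.
(* Representatives of all level-[n] classes lie in [W I]. A vertex outside [W I] would never have
   been separated from its representative, and saturation would put it into [W I]. *)
have [t [_ _ tm _]] := rep_seq n.
pose I := \max_(r <- t) dist r y.
have Wt r : r \in t -> W I r.
  by move=> rt; exists y; split=> //; rewrite /I (big_rem r rt) leq_maxl.
have [x xJ] := unb (J + I).
have xr := equiv_rep n x; have [u [Uu xu]] : W I x.
  apply: contrapT => Wx; apply: (Wx); apply: Wsat (Wt _ (tm x)) _.
  by rewrite equiv_sym; apply: Wout.
by have := lip x u; have := UJ u Uu; lia.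
Qed.

(* [mu.+1] is the first level at which some class is final, and [l] is the
   distance to that class; a vertex [x] has maximal type [mu + l x - 1]. *)
Record stratification (mu : nat) (l : V -> nat) : Prop := Stratification {
  lev_adj : forall x y, adj x y -> l y <= (l x).+1;
  lev_down : forall x, 0 < l x -> exists2 y, adj x y & l x = (l y).+1;
  lev_up : forall x, exists2 y, adj x y & l y = (l x).+1;
  lev_0 : exists x, l x = 0;
  lev_equiv : forall x y n, l x = l y -> equiv n x y;
  lev_sep : forall j x y, equiv (mu + j) x y -> l x < j -> l y = l x;
  lev_far : forall j x y, equiv mu x y -> j <= l x -> j <= l y -> equiv (mu + j) x y;
  lev_large : forall x j, exists2 y, equiv mu x y & j <= l y;
  lev_sim : forall x y, sim adj phi x y <-> l x = l y }.

(** * Distance from the first final class and the order of splitting *)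

Section FinalClass.
Variables (mu : nat) (x0 : V) (l : V -> nat).
Hypotheses (x0_final : final mu.+1 x0)
  (mu_min : forall x, ~ final mu x).
Let C x := equiv mu.+1 x0 x.
Hypothesis l_spec : forall x,
  (exists c, C c /\ dist x c = l x) /\ forall c, C c -> l x <= dist x c.

Let l_lip x y : l x <= l y + dist x y.
Proof.
have [[c [Cc <-]] _] := l_spec y; have [_ /(_ c Cc) xc] := l_spec x.
by rewrite addnC; apply: leq_trans xc (dist_triangle _ _ _).
Qed.

Let l_adj x y : adj x y -> l y <= (l x).+1.
Proof. by rewrite adjC => /dist_adj yx; have := l_lip y x; rewrite yx addn1. Qed.

Let l0P x : l x = 0 <-> C x.
Proof.
have [[c [Cc cE]] lmin] := l_spec x; split=> [x_0|Cx].
  by move/eqP: cE; rewrite x_0 dist_eq0 => /eqP ->.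
by apply/eqP; rewrite -leqn0; have := lmin x Cx; rewrite distxx.
Qed.

Let l_down x : 0 < l x -> exists2 y, adj x y & l x = (l y).+1.
Proof.
have [[c [Cc cE]] _] := l_spec x => lx0; rewrite -cE lt0n dist_eq0 in lx0.
have [xy yE] : adj x (par c x) /\ dist c x = (dist c (par c x)).+1.
  by apply: parP.
exists (par c x) => //; have := l_adj xy; rewrite adjC in xy; have := l_adj xy.
have [_ /(_ c Cc)] := l_spec (par c x); rewrite (distC _ c).
by rewrite (distC x) in cE; lia.
Qed.

(** Level [mu.+1] recognizes [C], and each further level recognizes one more neighborhood of it. *)
Let l_sat j x y : equiv (mu + j).+1 x y -> l x <= j -> l y <= j.
Proof.
elim: j x y => [|j IH] x y.
  rewrite addn0 !leqn0 => xy /eqP/l0P Cx; apply/eqP/l0P.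
  exact: equiv_trans Cx xy.
rewrite addnS => xy; rewrite leq_eqVlt ltnS => /orP[/eqP xj|xj]; last first.
  exact/leqW/(IH x y (equiv_pred xy)).
have [|u xu uE] := l_down (x := x); first by rewrite xj.
have [v yv uv] := equiv_nb xy xu.
have := IH u v uv; rewrite adjC in yv; have := l_adj yv; lia.
Qed.

Let l_sep j x y : equiv (mu + j).+1 x y -> l x <= j -> l y = l x.
Proof.
move=> xy xj.
have yx : l y <= l x by apply: (l_sat _ (leqnn _)); apply: equiv_le xy; lia.
apply/eqP; rewrite eqn_leq yx /=; apply: (l_sat _ (leqnn _)).
by rewrite equiv_sym; apply: equiv_le xy; lia.
Qed.

Let C_equiv c c' n : C c -> C c' -> equiv n c c'.
Proof.
by move=> /x0_final cE /x0_final; move: (cE n); rewrite equiv_sym;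
  move=> cx /(_ n); apply: equiv_trans.
Qed.

(** Otherwise, all vertices of [C] looking alike, the [j]-ball [s] around [x0] would meet every
    class of every level; but level [size s] has [size s + 1] classes. *)
Let l_unbounded j : exists x, j < l x.
Proof.
apply: contrapT => bd; have [s sE] := finite_ball x0 j.
have [t [ut tn tm tr']] := rep_seq (size s).
have : size t <= size (map (rep (size s)) s).
  apply: uniq_leq_size ut _ => r /tr' <-.
  have [[c [Cc cE]] _] := l_spec r.
  have rj : dist c r <= j.
    by rewrite distC cE leqNgt; apply/negP => jr; apply: bd; exists r.
  have cx0 i : equiv i c x0 by apply: C_equiv => //; apply: equiv_refl.
  have [z /sE zs rz] := equiv_within (size s) cx0 rj.
  by move/repP: rz => ->; apply: map_f.
by rewrite size_map tn ltnn.
Qed.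

Let no_split j n (U : V -> Prop) y y' : (forall x, U x -> l x <= j) ->
  (forall x z, U x -> equiv n x z -> U z) -> U y -> ~~ split_at n y y'.
Proof. by move=> Uj Usat; apply: no_split_inside l_lip l_unbounded Uj Usat _ _. Qed.

Let l_final x j m y : l x <= j -> equiv (mu + j).+1 x y -> equiv m x y.
Proof.
move=> xj xy; apply: (finalP (n := (mu + j).+1) _ xy) => i z jm.
apply: (no_split (j := j) (U := fun z => l z <= j)) => // u w uj uw.
by apply: l_sat uj; apply: equiv_le uw.
Qed.

Let x0_split : exists y, split_at mu x0 y.
Proof.
apply: contrapT => nsplit; apply: (mu_min (x := x0)) => y xy m.
apply: x0_final; apply: contraT => nxy; case: nsplit.
by exists y; rewrite /split_at xy.
Qed.

(** If both halves lay in [l <= j], this set would be saturated already at level [mu + j] and would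
    contain a splitting class. One half does, by induction: it is adjacent to the half found at the
    previous level, and at level [mu] the class [C] itself splits off. *)
Let l_split j a a' : split_at (mu + j) a a' -> (l a <= j) = ~~ (l a' <= j).
Proof.
move=> saa'; have both : ~~ ((l a <= j) && (l a' <= j)).
  apply/negP => /andP[aj a'j]; have := saa'; apply/negP.
  apply: (no_split (j := j) (U := fun z => l z <= j)) => // x y xj xy.
  have [/l_sat|nxy] := boolP (equiv (mu + j).+1 x y); first exact.
  have sxy : split_at (mu + j) x y by rewrite /split_at xy.
  by have [[_]|[_]] := split_unique saa' sxy; rewrite equiv_sym => /l_sat; apply.
suff some : (l a <= j) || (l a' <= j) by move: both some; do 2 case: (_ <= _).
elim: j a a' saa' {both} => [|j IH] a a'.
  have [y sy] := x0_split; rewrite addn0 => saa'; rewrite !leqn0.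
  have [[ax _]|[_ ax]] := split_unique sy saa'.
    by apply/orP; left; apply/eqP/l0P; rewrite /C equiv_sym.
  by apply/orP; right; apply/eqP/l0P; rewrite /C equiv_sym.
rewrite addnS => /split_nb [z [z' [az a'z' /IH /orP zj]]].
rewrite adjC in az; rewrite adjC in a'z'.
have := l_adj az; have := l_adj a'z'.
by case: zj => zj ? ?; apply/orP; [left|right]; lia.
Qed.

(* A class that is final without having split off from the class of [C] and
   its neighborhoods would, together with them, contain a splitting class. *)
Let l_in_split x : exists y, split_at (mu + l x) x y.
Proof.
apply: contrapT => nsplit.
have fx1 : final (mu + l x).+1 x.
  by move=> y xy m; apply: l_final xy.
have fx : final (mu + l x) x.
  move=> y xy; apply: fx1; apply: contraT => nxy; case: nsplit.
  by exists y; rewrite /split_at xy.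
have ex : exists i, `[< final i x >] by exists (mu + l x); apply/asboolP.
case: (ex_minnP ex) => i /asboolP fi imin.
have i_le : i <= mu + l x by apply/imin/asboolP.
have mu_i : mu < i.
  rewrite ltnNge; apply/negP => i_mu; apply: (mu_min (x := x)).
  by move=> y xy; apply: fi; apply: equiv_le xy.
have [x' sxx'] : exists x', split_at i.-1 x x'.
  apply: contrapT => ns; have : i <= i.-1; last by lia.
  apply/imin/asboolP => y xy; apply: fi; apply: contraT => nxy; case: ns.
  by exists y; rewrite /split_at xy; case: (i) mu_i nxy.
have [j iE jl] : exists2 j, i.-1 = mu + j & j < l x.
  by exists (i.-1 - mu); lia.
rewrite iE in sxx'; have iS : i = (mu + j).+1 by lia.
have x'j : l x' <= j by have := l_split sxx'; rewrite leqNgt jl /= => /esym/negbFE.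
have := sxx'; apply/negP.
apply: (no_split (j := l x) (U := fun z => l z <= j \/ equiv i x z)).
- move=> z [zj|/fi xz]; first by lia.
  by rewrite (l_sep (xz _) (leqnn _)).
- move=> u v uU uv; have [uv1|nuv] := boolP (equiv i u v).
    case: uU => [uj|xu]; [left | by right; apply: equiv_trans xu uv1].
    by apply: l_sat uj; rewrite -iS.
  have suv : split_at (mu + j) u v by rewrite /split_at uv -iS.
  have [[_]|[_]] := split_unique sxx' suv; rewrite -iS equiv_sym => xv; last by right.
  by left; rewrite iS in xv; apply: l_sat xv x'j.
- by right; apply: equiv_refl.
Qed.

Let l_equiv x y n : l x = l y -> equiv n x y.
Proof.
move=> xy; have [x' sx] := l_in_split x; have [y' sy] := l_in_split y.
apply: (l_final n (leqnn (l x))); rewrite -xy in sy.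
have := l_split sx; rewrite leqnn => /esym nx'.
have [[yx _]|[yx' _]] := split_unique sx sy; first by rewrite equiv_sym.
by move: nx'; rewrite (l_sat yx') // -xy.
Qed.

Let l_far j x y : equiv mu x y -> j <= l x -> j <= l y -> equiv (mu + j) x y.
Proof.
move=> xy; elim: j => [|j IH] xj yj; first by rewrite addn0.
rewrite addnS; apply: contraT => nxy.
have : split_at (mu + j) x y by rewrite /split_at IH // ltnW.
by move=> /l_split; rewrite [l x <= j]leqNgt [l y <= j]leqNgt xj yj.
Qed.

Let l_large x j : exists2 y, equiv mu x y & j <= l y.
Proof.
apply: contrapT => nlarge; apply: (mu_min (x := x)); apply: finalP => m y mu_m.
apply: (no_split (j := j) (U := equiv mu x)) (equiv_refl mu x).
  by move=> z xz; apply/ltnW; rewrite ltnNge; apply/negP => jz; apply: nlarge; exists z.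
by move=> z w xz zw; apply: equiv_trans xz (equiv_le mu_m zw).
Qed.

Let l_up x : exists2 y, adj x y & l y = (l x).+1.
Proof.
have [z] := l_unbounded (l x); elim: {z}_.+1 {-2}z (ltnSn (l z)) => // n IH z zn.
rewrite leq_eqVlt => /orP[/eqP zE|xz].
  have [|u zu uE] := l_down (x := z); first by rewrite -zE.
  have ux : l u = l x by rewrite -zE in uE; case: uE.
  rewrite adjC in zu.
  have [v xv zv] := equiv_nb (l_equiv (mu + l z).+2 ux) zu.
  by exists v; rewrite // (l_sep zv (leqnn _)) zE.
have [|u _ uE] := l_down (x := z); first by lia.
by apply: (IH u); lia.
Qed.

Let split_level m x y : split_at m x y -> m <= mu + l x.
Proof.
move=> sxy; rewrite leqNgt; apply/negP => lm; have := sxy; apply/negP.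
by apply: final_split lm => z xz i; apply: l_final xz.
Qed.

Let max_typeE x :
  max_type adj phi x = if mu + l x is t.+1 then t%:Z%R else (-1)%R.
Proof.
rewrite /max_type; have [y sxy] := l_in_split x.
have lub t : mu + l x = t.+1 -> forall m, type_set adj phi x m -> m <= t.
  by move=> E m /type_setP [z /split_level]; rewrite E ltnS.
case: xgetP => [z _ [n [/type_setP [y' sxy'] nmax] <-] | nex].
  case E: (mu + l x) => [|t]; first by have := split_level sxy'; rewrite E.
  congr (_%:Z)%R; apply/eqP; rewrite eqn_leq; apply/andP; split.
    by apply: (lub t) => //; apply/type_setP; exists y'.
  by apply: nmax; apply/type_setP; exists y; rewrite -E.
case E: (mu + l x) => [//|t]; case: (nex t%:Z%R); exists t => //; split.
  by apply/type_setP; exists y; rewrite -E.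
exact: lub.
Qed.

Let l_sim x y : sim adj phi x y <-> l x = l y.
Proof.
rewrite /sim !max_typeE; split=> [|->] //.
case Ex: (mu + l x) => [|t]; case Ey: (mu + l y) => [|u] //; first by lia.
by move=> [tu]; lia.
Qed.

Lemma final_class_stratification : stratification mu l.
Proof.
split=> //; first by exists x0; apply/l0P/equiv_refl.
move=> [|j] x y; first by [].
by rewrite addnS ltnS; apply: l_sep.
Qed.

End FinalClass.

Lemma sturmian_stratification :
  bounded_type adj phi -> exists mu l, stratification mu l.
Proof.
move=> /bounded_type_final [n [x fx]].
have ex : exists n, `[< exists x, final n x >].
  by exists n; apply/asboolP; exists x.
case: (ex_minnP ex) => -[|mu] /asboolP [x0 fx0] mu_min.
  (* Level 0 has a single class and that class splits, so the first final level is positive. *)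
  have [y [z /andP[_ /negP]]] := split_exists 0; case.
  by rewrite -(equiv_transl z (fx0 y isT 1)) fx0.
have lex x1 : exists m, `[< exists c, equiv mu.+1 x0 c /\ dist x1 c = m >].
  by exists (dist x1 x0); apply/asboolP; exists x0; rewrite equiv_refl.
exists mu, (fun x1 => ex_minn (lex x1)).
apply: final_class_stratification fx0 _ _.
  move=> x1 fx1; have : mu < mu by apply: mu_min; apply/asboolP; exists x1.
  by rewrite ltnn.
move=> x1; case: ex_minnP => m /asboolP mex mmin; split=> // c Cc.
by apply: mmin; apply/asboolP; exists c.
Qed.

(** * Consequences of a stratification; level 0 is called the core *)

Section Levels.
Variables (mu : nat) (l : V -> nat).
Hypothesis st : stratification mu l.

Lemma lev_adjV x y : adj x y -> l x <= (l y).+1.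
Proof. by rewrite adjC; apply: lev_adj st _ _. Qed.

Lemma lev_dist x y : l y <= l x + dist x y.
Proof.
have /ballE [p [pp <- sp]] := leqnn (dist x y).
suff : l (last x p) <= l x + size p by lia.
elim: p x {sp y} pp => [|a p IH] x /=; first by rewrite addn0.
by move=> /andP[/(lev_adj st) xa /IH]; lia.
Qed.

Lemma lev_near x : exists2 c, l c = 0 & dist x c <= l x.
Proof.
elim: {x}(l x) {-2}x (erefl (l x)) => [|n IH] x xE.
  by exists x; rewrite // distxx.
have [|y xy yE] := lev_down st (x := x); first by rewrite xE.
have [|c c0 yc] := IH y; first by lia.
exists c => //; apply: leq_trans (dist_triangle x y c) _.
by rewrite (dist_adj xy) add1n yE.
Qed.

Lemma lev_climb x n : exists2 y, l y = l x + n & dist x y <= n.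
Proof.
elim: n => [|n [y yE xy]]; first by exists x; rewrite ?addn0 ?distxx.
have [z yz zE] := lev_up st y; exists z; first by rewrite zE yE addnS.
by apply: leq_trans (dist_adj_le x yz) _.
Qed.

Lemma lev_surj i : exists x, l x = i.
Proof.
have [x x0] := lev_0 st; have [y yE _] := lev_climb x i.
by exists y; rewrite yE x0.
Qed.

Lemma lev_nb_perm x y : l x = l y -> perm_eq (map l (nb x)) (map l (nb y)).
Proof.
(* Deep enough for [lev_sep] to read off the levels of the neighbors, which are at most
   [(l x).+1]. *)
move=> xy; have := lev_equiv st (mu + (l x).+2).+1 xy.
rewrite equivS => /andP[_ /perm_map_lift [s [ps sE]]].
rewrite -(permPr (perm_map l ps)).
rewrite -(map_eq_transfer (g := l) sE) ?perm_refl // => u v.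
rewrite (perm_mem ps) !mem_nb => yu xv /repP; rewrite equiv_sym => vu.
by apply/(lev_sep st vu); have := lev_adj st xv; rewrite ltnS.
Qed.

(* [nlow <= 1] everywhere characterizes the two rays of the theorem. *)
Definition nlow x := count (fun y => l y <= l x) (nb x).

Lemma nlow_lev x y : l x = l y -> nlow x = nlow y.
Proof.
move=> xy; have /permP/(_ (leq^~ (l x))) := lev_nb_perm xy.
by rewrite !count_map /nlow -xy.
Qed.

Lemma nlow_unique x u v : nlow x <= 1 -> adj x u -> adj x v ->
  l u <= l x -> l v <= l x -> u = v.
Proof.
rewrite /nlow -size_filter => low xu xv ux vx; apply/eqP; apply: contraT => uv.
suff : 2 <= 1 by [].
apply: leq_trans low; apply: (@uniq_leq_size _ [:: u; v]).
  by rewrite /= inE uv.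
by move=> w; rewrite !inE mem_filter mem_nb => /orP[] /eqP ->; rewrite ?ux ?vx.
Qed.

Lemma nlow_two x : 2 <= nlow x -> exists u v,
  [/\ adj x u, adj x v, u != v, l u <= l x & l v <= l x].
Proof.
rewrite /nlow -size_filter; set s := filter _ _.
have : uniq s by rewrite filter_uniq ?nb_uniq.
have sP w : w \in s -> adj x w /\ l w <= l x.
  by rewrite mem_filter mem_nb => /andP[].
case: s sP => [|u [|v s]] // sP /= /andP[+ _] _.
rewrite inE negb_or => /andP[uv _]; exists u, v.
have [xu ux] := sP u (mem_head _ _).
by have [|xv vx] := sP v; rewrite ?inE ?eqxx ?orbT.
Qed.

Lemma nlow_row x : 0 < l x -> nlow x <= 1 ->
  perm_eq (map l (nb x)) ((l x).-1 :: nseq k.-1 (l x).+1).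
Proof.
move=> /(lev_down st) [d xd dE] low; have dn : d \in nb x by rewrite mem_nb.
apply: perm_trans (perm_map l (perm_to_rem dn)) _; rewrite dE /= perm_cons.
have : all (pred1 (l d).+2) (map l (rem d (nb x))).
  apply/allP => _ /mapP [u + ->]; rewrite mem_rem_uniq ?nb_uniq // !inE mem_nb.
  move=> /andP[ud xu]; have := lev_adj st xu; rewrite eqn_leq -dE.
  move=> -> /=; rewrite ltnNge; apply: contra ud => ux.
  by apply/eqP; apply: nlow_unique low xu xd ux _; rewrite dE.
by move/all_pred1P => ->; rewrite size_map size_rem // size_nb perm_refl.
Qed.

(** Every edge between consecutive levels can be used from an end of positive level. The restriction
    matters because rows of a level-[mu] class are known to agree only away from the core. *)
Lemma lev_closed (Z : V -> Prop) : (forall x y, l x = l y -> Z x -> Z y) ->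
  (forall x y, 0 < l x -> Z x -> adj x y -> Z y) ->
  (exists2 x, Z x & 0 < l x) -> forall y, Z y.
Proof.
move=> Zl Znb [x Zx x0].
have up n y : l y = l x + n -> Z y.
  elim: n y => [|n IH] y yE; first by apply: Zl Zx; rewrite yE addn0.
  have [|d yd dE] := lev_down st (x := y); first by lia.
  by apply: (Znb d); rewrite 1?adjC //; [lia | apply: IH; lia].
have down n y : l y + n = l x -> Z y.
  elim: n y => [|n IH] y yE; first by apply: Zl Zx; rewrite -yE addn0.
  have [u yu uE] := lev_up st y.
  by apply: (Znb u); rewrite 1?adjC //; [lia | apply: IH; lia].
move=> y; have [xy|xy] := leqP (l x) (l y).
  by apply: (up (l y - l x)); lia.
by apply: (down (l x - l y)); lia.
Qed.

Lemma lev_class : exists q : nat -> V, forall y, rep mu y = q (l y).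
Proof.
have [X XE] := choice lev_surj; exists (fun i => rep mu (X i)) => y.
by apply/repP/(lev_equiv st); rewrite XE.
Qed.

Lemma equiv_row x y : equiv mu x y -> 0 < l x -> 0 < l y ->
  perm_eq (map (rep mu) (nb x)) (map (rep mu) (nb y)).
Proof.
move=> xy x0 y0; have := lev_far st xy x0 y0.
by rewrite addn1 equivS => /andP[].
Qed.

Lemma equiv_lt_mu : 0 < mu -> exists x y, ~~ equiv mu x y.
Proof.
by case: (mu) => // m _; have [x [y /andP[_ nxy]]] := split_exists m; exists x, y.
Qed.

(** A vertex in the middle of the band and all its neighbors see one color far enough to share a
    level-[mu] class. By [lev_far] that class is closed under neighbors away from the core, so it is
    everything, whereas [mu > 0] leaves at least two classes. *)
Lemma monochrome_levels a (c : A) :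
  (forall x, a <= l x <= a + mu.*2.+2 -> phi x = c) -> mu = 0.
Proof.
move=> col.
have eqv r x y : a + r <= l x -> l x + r <= a + mu.*2.+2 ->
    a + r <= l y -> l y + r <= a + mu.*2.+2 -> equiv r.+1 x y.
  elim: r x y => [|r IH] x y ax xb ay yb.
    rewrite equivS !col ?eqxx /=; try lia.
    have cE s : map (rep 0) s = nseq (size s) (rep 0 x).
      by elim: s => //= z s ->; congr (_ :: _); apply/repP.
    by rewrite !cE !size_nb.
  rewrite equivS !col ?eqxx /=; try lia.
  have rowE z : a + r.+1 <= l z -> l z + r.+1 <= a + mu.*2.+2 ->
      map (rep r.+1) (nb z) = nseq k (rep r.+1 x).
    move=> az zb; have /all_pred1P -> : all (pred1 (rep r.+1 x)) (map (rep r.+1) (nb z)).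
      apply/allP => _ /mapP [w + ->]; rewrite mem_nb => zw; apply/eqP/repP.
      by apply: IH; have := lev_adj st zw; have := lev_adjV zw; lia.
    by rewrite size_map size_nb.
  by rewrite !rowE.
apply/eqP; apply: contraT; rewrite -lt0n => /equiv_lt_mu [u [v /negP]]; case.
have [x xE] := lev_surj (a + mu.+1).
have xnb y : adj x y -> equiv mu x y.
  move=> xy; apply: equiv_pred; apply: eqv; rewrite ?xE; try lia.
    by have := lev_adjV xy; lia.
  by have := lev_adj st xy; lia.
suff all y : equiv mu x y by apply: equiv_trans (all v); rewrite equiv_sym.
apply: (lev_closed (Z := equiv mu x)) => [z t zt xz|z t z0 xz zt|].
- by apply: equiv_trans xz (lev_equiv st _ zt).
- have zx : equiv mu.+1 z x.
    by rewrite -addn1; apply: (lev_far st); rewrite // 1?equiv_sym // xE; lia.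
  have [w xw tw] := equiv_nb zx zt.
  by apply: equiv_trans (xnb w xw) _; rewrite equiv_sym.
- by exists x; rewrite ?equiv_refl // xE; lia.
Qed.

Section Regime.
Variables (j : nat) (q : nat -> V).
Hypothesis low : forall x, j < l x -> nlow x <= 1.
Hypothesis qE : forall y, rep mu y = q (l y).

Let rowE x : map (rep mu) (nb x) = map q (map l (nb x)).
Proof. by rewrite -map_comp; apply: eq_map. Qed.

Let row x : j < l x ->
  perm_eq (map (rep mu) (nb x)) (q (l x).-1 :: nseq k.-1 (q (l x).+1)).
Proof.
move=> jx; rewrite rowE -map_nseq -map_cons; apply: perm_map.
by apply: nlow_row (low jx); lia.
Qed.

Let row_eq i i' : j < i -> j < i' -> q i = q i' ->
  perm_eq (q i.-1 :: nseq k.-1 (q i.+1)) (q i'.-1 :: nseq k.-1 (q i'.+1)).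
Proof.
have [x <-] := lev_surj i; have [y <-] := lev_surj i' => jx jy.
rewrite -!qE => /repP xy; rewrite -(permPl (row jx)) -(permPr (row jy)).
by apply: equiv_row xy _ _; lia.
Qed.

(** By [row_eq], two consecutive values of [q] determine the next one and also the previous one. A
    pair repeats by finiteness, and the repetition spreads both upwards and down to [j]. *)
Lemma lev_class_periodic :
  exists2 P, 0 < P & forall i, j <= i -> q (i + P) = q i.
Proof.
have [t [_ _ tm _]] := rep_seq mu.
have qt i : q i \in t by have [x <-] := lev_surj i; rewrite -qE.
have [|a [b [ab [e0 e1]]]] := pigeonhole (f := fun i => (q (j + i), q (j + i).+1))
  (s := [seq (u, v) | u <- t, v <- t]).
  by move=> i; apply/allpairsP; exists (q (j + i), q (j + i).+1); rewrite /= !qt.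
exists (b - a); first by lia.
pose e i := q (i + (b - a)) = q i /\ q (i.+1 + (b - a)) = q i.+1.
have ea : e (j + a).
  rewrite /e (_ : j + a + (b - a) = j + b); last by lia.
  by rewrite (_ : (j + a).+1 + (b - a) = (j + b).+1) //; lia.
have step i : j <= i -> q (i.+1 + (b - a)) = q i.+1 ->
    perm_eq (q (i + (b - a)) :: nseq k.-1 (q (i.+2 + (b - a))))
            (q i :: nseq k.-1 (q i.+2)).
  by move=> ji /row_eq; rewrite !addSn /=; apply; lia.
have up n : e (j + a + n).
  elim: n => [|n [IH0 IH1]]; first by rewrite addn0.
  rewrite addnS; split=> //; have := step _ _ IH1; rewrite IH0 perm_cons.
  move=> /(_ _)/perm_mem E; have := E _ (q ((j + a + n).+2 + (b - a))).
  rewrite !mem_nseq eqxx (_ : 0 < k.-1) /=; last by lia.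
  by move=> H; apply/eqP; rewrite -H //; lia.
have down n : n <= a -> e (j + (a - n)).
  elim: n => [|n IH] na; first by rewrite subn0.
  have := IH (ltnW na); rewrite (_ : j + (a - n) = (j + (a - n.+1)).+1); last by lia.
  move=> [e0' e1']; split=> //; have := step _ _ e0'; rewrite e1'.
  rewrite -cat1s -[q (j + (a - n.+1)) :: _]cat1s perm_cat2r.
  move=> /(_ _)/perm_mem E; have := E _ (q (j + (a - n.+1))).
  by rewrite !inE eqxx eq_sym => H; apply/eqP; rewrite H //; lia.
move=> i ji; have [ia|ai] := leqP (j + a) i.
  by have [] := up (i - (j + a)); rewrite subnKC.
by have [] := down (a - (i - j)) (leq_subr _ _); rewrite (_ : j + _ = i) //; lia.
Qed.

(* Since [k >= 3], the class [q i] of a level [i > j] determines [q i.-1] and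
   [q i.+1]. Comparing level [j] with a higher level of the same class, one finds
   that all neighbors of [q j] are in [q j.+1] and conversely, which leaves at
   most two classes at level [mu]. *)
Lemma bad_level_mu x0 : 0 < j -> l x0 = j -> 2 <= nlow x0 -> mu <= 1.
Proof.
move=> j0 x0j bad; rewrite leqNgt; apply/negP => mu2.
(* [x0] has two neighbors that are not above it and one that is. *)
have k3 : 2 <= k.-1.
  have [u x0u uE] := lev_up st x0; have un : u \in nb x0 by rewrite mem_nb.
  have := size_nb x0; rewrite (perm_size (perm_to_rem un)) /= => <- /=.
  apply: leq_trans bad _; rewrite /nlow (permP (perm_to_rem un)) /= uE ltnn add0n.
  exact: count_size.
have det i i' : j < i -> j < i' -> q i = q i' -> q i.-1 = q i'.-1 /\ q i.+1 = q i'.+1.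
  by move=> ji ji' /(row_eq ji ji')/(perm_cons_nseq k3).
(* The class of level [j.+1] recurs at arbitrarily high levels; [i] is one step below such a
   recurrence. *)
have [i [ji [qi qiS]]] : exists i, j.+1 < i /\ q i = q j /\ q i.+1 = q j.+1.
  have [y yE] := lev_surj j.+1; have [z yz jz] := lev_large st y j.+3.
  have qz : q (l z) = q j.+1 by rewrite -qE -yE -qE; apply/esym/repP.
  exists (l z).-1; rewrite prednK; last by lia.
  by have [] := det (l z) j.+1 _ _ qz; do ?[split=> //]; lia.
have rows x i' : 0 < l x -> j < i' -> q (l x) = q i' ->
    perm_eq (map (rep mu) (nb x)) (q i'.-1 :: nseq k.-1 (q i'.+1)).
  have [y <-] := lev_surj i' => lx jy; rewrite -!qE => /repP xy.
  by rewrite -(permPr (row jy)); apply: equiv_row xy lx _; lia.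
have nbrs x i' u : 0 < l x -> j < i' -> q (l x) = q i' -> adj x u ->
    q (l u) = q i'.-1 \/ q (l u) = q i'.+1.
  move=> lx ji' /(rows x i' lx ji')/perm_mem E; rewrite -mem_nb => xu.
  have := map_f (rep mu) xu; rewrite E inE mem_nseq qE => /orP[/eqP|/andP[_ /eqP]]; tauto.
(* Level [mu >= 2] has at least three classes. *)
have no_two (a b : V) : ~ forall y, q (l y) = a \/ q (l y) = b.
  move=> ab; have [t [ut tn tm tr']] := rep_seq mu.
  have : size t <= size [:: a; b].
    apply: uniq_leq_size ut _ => r /tr' <-; rewrite qE !inE.
    by case: (ab r) => ->; rewrite eqxx ?orbT.
  by rewrite tn /=; lia.
have closed (a b : V) : (forall x y, 0 < l x -> q (l x) = a \/ q (l x) = b ->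
    adj x y -> q (l y) = a \/ q (l y) = b) -> q j <> a.
  move=> cl qa; apply: (no_two a b); apply: lev_closed => //.
    by move=> x y ->.
  by exists x0; rewrite x0j //; left.
have neq : q j <> q j.+1.
  move=> qq; have [_ q2] := det i j.+1 (ltnW ji) (ltnSn j) (etrans qi qq).
  have [q0 _] := det i j.+1 (ltnW ji) (ltnSn j) (etrans qi qq).
  rewrite /= in q0.
  apply: (closed (q j) (q j)) => // x y lx qx xy.
  have {}qx : q (l x) = q i by rewrite qi; case: qx.
  by have := nbrs x i y lx (ltnW ji) qx xy; rewrite q0 qiS -qq.
have ji1 : j < i.-1 by lia.
have iE : i.-1.+1 = i by lia.
have {}ji := ltnW ji.
have x0i : q (l x0) = q i by rewrite x0j.
have lx0 : 0 < l x0 by rewrite x0j.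
have nbj u : adj x0 u -> l u <> j.
  move=> x0u uj; have := nbrs x0 i u lx0 ji x0i x0u; rewrite uj qiS => -[qm|//].
  have [_] := det i.-1 i ji1 ji (etrans (esym qm) (esym qi)).
  by rewrite iE qi qiS; apply: neq.
have nb_lev u : adj x0 u -> l u = j.-1 \/ l u = j.+1.
  move=> x0u; have := nbj u x0u; have := lev_adjV x0u; have := lev_adj st x0u.
  by rewrite x0j; lia.
(* A row has only one place for [q i.-1], so of the two neighbors at level [j.-1] at least one has
   class [q i.+1 = q j.+1]. *)
have qjm : q j.-1 = q j.+1.
  have [u [v [x0u x0v uv]]] := nlow_two bad; rewrite x0j => uj vj.
  have {uj} uj : l u = j.-1 by have [|] := nb_lev u x0u; lia.
  have {vj} vj : l v = j.-1 by have [|] := nb_lev v x0v; lia.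
  have [|] := nbrs x0 i u lx0 ji x0i x0u; rewrite uj ?qiS // => qi1.
  have := rows x0 i lx0 ji x0i; have un : u \in nb x0 by rewrite mem_nb.
  rewrite (permPl (perm_map (rep mu) (perm_to_rem un))) /= qE uj qi1 perm_cons.
  move=> /perm_mem/(_ (rep mu v)); rewrite map_f; last first.
    by rewrite mem_rem_uniq ?nb_uniq // !inE mem_nb eq_sym uv.
  by rewrite mem_nseq qE vj qiS qi1 => /esym/andP[_ /eqP].
have qim : q i.-1 = q j.+1.
  have /perm_mem/(_ (q i.-1)) := rows x0 i lx0 ji x0i.
  rewrite mem_head => /mapP [y]; rewrite mem_nb qE => /nb_lev [] -> ->//.
have [_] := det i.-1 j.+1 ji1 (ltnSn j) qim; rewrite iE qi => qj2.
apply: (closed (q j) (q j.+1)) => // x y lx [qx|qx] xy.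
  have := nbrs x i y lx ji _ xy; rewrite qx qi qim qiS => /(_ erefl) [] ->; by right.
have := nbrs x j.+1 y lx (ltnSn j) qx xy; rewrite /= -qj2 => -[] ->; by left.
Qed.

End Regime.

(** * Eventually periodic colorings *)

Definition core_free (o z : V) : Prop := forall y, branch o z y -> 0 < l y.

(** The core lies outside the branch, so every path from [u] to it runs through [y]. *)
Lemma core_free_child o z y u : core_free o z -> branch o z y ->
  u \in children o y -> l u = (l y).+1.
Proof.
move=> cf zy uy; have yu := branch_child uy.
have := uy; rewrite mem_children => /andP[ayu _].
apply/eqP; rewrite eqn_leq (lev_adj st ayu) /= ltnNge; apply/negP => lu.
have [c c0 uc] := lev_near u.
have nuc : ~ branch o u c.
  by move=> uc'; have := cf c (branch_trans zy (branch_trans yu uc')); rewrite c0.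
by have := branch_par uy nuc; have := lev_dist c y; rewrite c0 (distC c); lia.
Qed.

(** In the branch only the parent can fail to be farther from the core. All levels from [l z] on
    occur there, and [nlow] depends on the level alone. *)
Lemma core_free_nlow o z x : core_free o z -> l z <= l x -> nlow x <= 1.
Proof.
move=> cf zx; have up n : exists2 y, branch o z y & l y = l z + n.
  elim: n => [|n [y zy yE]]; first by exists z; [apply: branch_refl | rewrite addn0].
  have [u uy] := exists_child o y; exists u.
    exact: branch_trans zy (branch_child uy).
  by rewrite (core_free_child cf zy uy) yE addnS.
have [y zy yE] := up (l x - l z).
rewrite (nlow_lev (y := y)); last by lia.
rewrite leqNgt; apply/negP => /nlow_two [u [v [yu yv uv uy vy]]].
have lowp w : adj y w -> l w <= l y -> par o y = w.
  move=> yw wy; have [wE|/(parE yw) //] := dist_adj_cases o yw.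
  have wc : w \in children o y by rewrite mem_children yw wE eqxx.
  by move: wy; rewrite (core_free_child cf zy wc) ltnn.
by rewrite -(lowp u yu uy) -(lowp v yv vy) eqxx in uv.
Qed.

Section Piece.
Variables (G : set (V -> V)) (psi : V -> A) (S : set V) (o z : V).
Hypotheses (Ggroup : automorphism_group adj G) (Gcof : cofinite_group G)
  (Gpsi : forall g, G g -> forall x, psi (g x) = psi x)
  (Sphi : forall x, S x -> psi x = phi x)
  (Sz : forall y, branch o z y -> S y).

(** At depth [D + n] the branch contains a ball of radius [D + n], and some translate of [v] is
    within [D] of its center. *)
Lemma piece_return v n :
  exists2 g, G g & forall u, dist v u <= n -> branch o z (g u).
Proof.
have [D vD] := cofinite_group_dist v Ggroup Gcof.
have [x [ox zx]] := exists_descendant o z (D + n).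
have zbx : branch o z x by rewrite /branch ox zx.
have [g Gg xg] := vD x; exists g => // u vu.
have gaut : automorphism adj g by case: Ggroup => + _ _ _; apply.
apply: (branch_ball zbx (leqnn _)); rewrite zx.
apply: leq_trans (dist_triangle x (g v) (g u)) _.
by rewrite (automorphism_dist _ _ gaut) leq_add.
Qed.

Lemma piece_equiv g v n : G g -> (forall u, dist v u <= n -> S u) ->
  (forall u, dist v u <= n -> S (g u)) -> equiv n.+1 v (g v).
Proof.
move=> Gg Sv Sgv; apply: automorphism_equiv; first by case: Ggroup => + _ _ _; apply.
by move=> u vu; rewrite -!Sphi ?Gpsi //; [apply: Sv | apply: Sgv].
Qed.

(* Otherwise the core would be relatively dense in [branch o z], in which
   the levels are unbounded. *)
Lemma piece_core_free c : l c = 0 -> ~ forall u, dist c u <= mu -> branch o z u.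
Proof.
move=> c0 cz; have [D cD] := cofinite_group_dist c Ggroup Gcof.
have low x : branch o z x -> D + mu <= dist z x -> l x <= D.
  move=> zx xz; have [g Gg xg] := cD x.
  have gaut : automorphism adj g by case: Ggroup => + _ _ _; apply.
  have gz u : dist c u <= mu -> branch o z (g u).
    move=> cu; apply: (branch_ball zx xz).
    apply: leq_trans (dist_triangle x (g c) (g u)) _.
    by rewrite (automorphism_dist _ _ gaut) leq_add.
  have := piece_equiv Gg (fun u cu => Sz (cz u cu)) (fun u cu => Sz (gz u cu)).
  rewrite -addn1 => /(lev_sep st); rewrite c0 => /(_ isT) gc0.
  by have := lev_dist (g c) x; rewrite gc0 distC; lia.
have [x [ox zx]] := exists_descendant o z (D.+1 + (D + mu)).
have zbx : branch o z x by rewrite /branch ox zx.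
have [y yE xy] := lev_climb x D.+1.
have zy : branch o z y.
  by apply: (branch_ball zbx _ xy); rewrite zx leq_addr.
have : l y <= D.
  apply: low => //; have := dist_triangle z y x; rewrite (distC y x) zx; lia.
by rewrite yE; lia.
Qed.

Lemma piece_core_free_branch : exists2 z', branch o z z' & core_free o z'.
Proof.
have [z' [oz' zz']] := exists_descendant o z mu.
have bz' : branch o z z' by rewrite /branch oz' zz'.
exists z' => // y z'y; rewrite lt0n; apply/eqP => /piece_core_free; apply => u yu.
apply: branch_ball (branch_trans bz' z'y) _ yu.
by rewrite (branch_dist bz' z'y) zz' leq_addr.
Qed.

End Piece.

(* Let [j] be the last level with [nlow >= 2]. Then [l <= j] defines a tree [W]
   without leaves; far from [K], some piece [S i] contains all of [W] beyond a
   vertex [z], and a branch avoiding the core. The balls of its periodic coloring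
   [psi] are then all balls of [phi] far from the core. This fails for a core
   vertex of [W] if [mu <= j], and for a ray of core vertices if [j = 0]. *)
Lemma eventually_periodic_nlow :
  eventually_periodic adj phi -> forall x, nlow x <= 1.
Proof.
move=> hper x; rewrite leqNgt; apply/negP => bad.
have [o o0] := lev_0 st.
have [K [_ /(branch_bounded o) [Z KZ] [m [S [KS SP]]]]] := hper.
have Ssub i : subtree adj (S i) by case: (SP i).
have inS z : Z < dist o z -> exists i, S i z.
  move=> Zz; have : (~` K) z by apply: KZ Zz (branch_refl _ _).
  by rewrite KS => -[i _ Siz]; exists i.
(* With all vertices as the leafless set, the dichotomy puts a whole branch into one piece;
   periodicity then gives a smaller branch without core vertices. *)
have sub z : Z < dist o z -> exists z' i,
    [/\ branch o z z', forall y, branch o z' y -> S i y & core_free o z'].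
  move=> Zz; have chT w : True -> exists2 w', w' \in children o w & True.
    by move=> _; have [w' ?] := exists_child o w; exists w'.
  have [z1 [_ zz1 z1S]] := subtrees_dichotomy chT (x := z) I Ssub.
  have [|i Siz1] := inS z1; first by move: zz1; rewrite /branch; lia.
  have {z1S} z1S : forall y, branch o z1 y -> S i y.
    have [H y|H] := z1S i; first exact: H.
    by case: (H z1 (branch_refl _ _)).
  have [_ [psi [[G [Ggr Gcof Gpsi]] Spsi]]] := SP i.
  have [z' z1z' cf] := piece_core_free_branch Ggr Gcof Gpsi Spsi z1S.
  exists z', i; split=> // [|y z'y]; first exact: branch_trans zz1 z1z'.
  exact/z1S/(branch_trans z1z').
have [z0 [oz0 _]] := exists_descendant o o Z.+1; rewrite distxx add0n in oz0.
have [|z1 [_ [_ _ cf1]]] := sub z0; first by rewrite oz0.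
have exj : exists j, `[< exists y, l y = j /\ 2 <= nlow y >].
  by exists (l x); apply/asboolP; exists x.
have jub j : `[< exists y, l y = j /\ 2 <= nlow y >] -> j <= l z1.
  move=> /asboolP [y [<- ybad]]; rewrite leqNgt; apply/negP => zy.
  by have := core_free_nlow cf1 (ltnW zy); lia.
case: (ex_maxnP exj jub) => j /asboolP [xj [xjE xjbad]] jmax {exj jub}.
have low y : j < l y -> nlow y <= 1.
  move=> jy; rewrite leqNgt; apply/negP => ybad; have : l y <= j; last by lia.
  by apply: jmax; apply/asboolP; exists y.
pose W y := l y <= j.
(* Below level [j] any child will do; at level [j] at most one of the two neighbors that are not
   above [w] is its parent. *)
have Wch w : W w -> exists2 w', w' \in children o w & W w'.
  rewrite /W leq_eqVlt => /orP[/eqP wj|wj]; last first.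
    have [w' ww'] := exists_child o w; exists w' => //.
    by move: ww'; rewrite mem_children => /andP[/(lev_adj st)]; lia.
  have : 2 <= nlow w by rewrite (nlow_lev (y := xj)) // wj xjE.
  move=> /nlow_two [u [v [wu wv uv]]]; rewrite wj => uj vj.
  have ch y : adj w y -> y != par o w -> y \in children o w.
    by move=> wy yp; rewrite /children mem_rem_uniq ?nb_uniq // !inE yp mem_nb.
  have [up|up] := eqVneq u (par o w); last by exists u => //; apply: ch.
  by exists v => //; apply: ch; rewrite // -up eq_sym.
have Wo : W o by rewrite /W o0.
have [x1 [Wx1 ox1 ox1E]] := branch_within Wch Z.+1 Wo.
have [z [Wz x1z zS]] := subtrees_dichotomy Wch Wx1 Ssub.
have Zz : Z < dist o z by move: x1z; rewrite /branch; lia.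
have [z' [i [zz' z'S cf]]] := sub z Zz.
have {zS} WS y : W y -> branch o z y -> S i y.
  have [H|H] := zS i; first exact: H.
  by case: (H z' zz' (z'S z' (branch_refl _ _))).
have [_ [psi [[G [Ggr Gcof Gpsi]] Spsi]]] := SP i.
have ret v n : exists2 g, G g & forall u, dist v u <= n -> branch o z' (g u).
  exact: piece_return Ggr Gcof v n.
(* If [mu <= j], the [mu]-ball of a core vertex lies in [l <= j]. Depth [mu + j] keeps it in the
   branch of [z], since the core is within [j] of [w]. Its translate into the core-free branch would
   again be centered in the core. *)
have [mu_j|j_mu] := leqP mu j.
  have [w [Ww zw zwE]] := branch_within Wch (mu + j) Wz.
  have [c c0 wc] := lev_near w.
  have [g Gg gz'] := ret c mu.
  have eqc : equiv mu.+1 c (g c).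
    apply: (piece_equiv Ggr Gpsi Spsi Gg) => u cu; last exact/z'S/gz'.
    apply: WS; first by have := lev_dist c u; rewrite /W c0; lia.
    apply: branch_ball zw (leqnn _) _; rewrite zwE.
    by have := dist_triangle w c u; rewrite /W in Ww; lia.
  have := lev_sep st (j := 1) (x := c) (y := g c); rewrite addn1 c0 => /(_ eqc isT).
  by have := cf (g c) (gz' c (_ : _)); rewrite distxx => /(_ isT); lia.
have [j0|j0] := posnP j; last first.
  have [q qE] := lev_class.
  by have := bad_level_mu low qE j0 xjE xjbad; lia.
have {Wch} /choice [nx nxP] : forall w, exists w', W w -> w' \in children o w /\ W w'.
  move=> w; have [/Wch [w' ww' Ww']|nW] := pselect (W w); first by exists w'.
  by exists w => Ww.
pose w t := iter t nx z.
have Ww t : W (w t) by elim: t => // t IH; apply: (nxP (w t) IH).2.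
have wS t : w t.+1 \in children o (w t) by apply: (nxP (w t) (Ww t)).1.
have ow t : dist o (w t) = dist o z + t.
  elim: t => [|t IH]; first by rewrite addn0.
  by have := wS t; rewrite mem_children IH addnS => /andP[_ /eqP].
have wadj t : adj (w t) (w t.+1) by have := wS t; rewrite mem_children => /andP[].
have zw t : branch o z (w t).
  elim: t => [|t IH]; first exact: branch_refl.
  exact: branch_trans IH (branch_child (wS t)).
have wd s t : dist (w s) (w (s + t)) <= t.
  elim: t => [|t IH]; first by rewrite addn0 distxx.
  by rewrite addnS; apply: leq_trans (dist_adj_le _ (wadj _)) _.
have w0 t : l (w t) = 0 by have := Ww t; rewrite /W j0; lia.
(* [N] steps upwards visit the [N.+1] levels required by [monochrome_levels]. The core path has
   twice that length because only one half of its image is sure to climb. *)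
pose N := mu.*2.+2.
have [g Gg gz'] := ret (w N) N.
have gaut : automorphism adj g by case: Ggr => + _ _ _; apply.
have wN t : t <= N + N -> dist (w N) (w t) <= N.
  move=> tN; have [le_t|lt_t] := leqP N t.
    by rewrite -(subnKC le_t); apply: leq_trans (wd _ _) _; lia.
  rewrite distC; have := wd t (N - t); rewrite (subnKC (ltnW lt_t)) => le.
  exact: leq_trans le (leq_subr _ _).
have gz t : t <= N + N -> branch o z' (g (w t)) by move=> /wN /gz'.
have gphi t : t <= N + N -> phi (g (w t)) = phi z.
  move=> tN; rewrite -Spsi; last exact/z'S/gz.
  rewrite Gpsi // Spsi; last exact: WS.
  by have := equiv_phi (lev_equiv st 1 (etrans (w0 t) (esym (w0 0)))).
have gneq t : g (w t) <> g (w t.+2).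
  move=> E; have [[h gK _] _] := gaut; move/(can_inj gK)/(congr1 (dist o)): E.
  by rewrite !ow; lia.
have gadj t : adj (g (w t)) (g (w t.+1)) by rewrite gaut.2.
(* After a step up, the vertex just left is the only neighbor that is not above, so a path without
   backtracking keeps climbing. *)
have climb (f : nat -> V) : (forall t, t <= N -> 0 < l (f t)) ->
    (forall t, t < N -> adj (f t) (f t.+1)) ->
    (forall t, t.+1 < N -> f t <> f t.+2) -> l (f 1) = (l (f 0)).+1 ->
    forall t, t <= N -> l (f t) = l (f 0) + t.
  move=> fpos fadj fneq f1 t; elim/ltn_ind: t => -[|[|t]] IH tN.
  - by rewrite addn0.
  - by rewrite addn1.
  have E1 := IH t.+1 (ltnSn _) (ltnW tN); have E0 := IH t (leqnSn _) (ltnW (ltnW tN)).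
  apply/eqP; rewrite eqn_leq; apply/andP; split.
    by have := lev_adj st (fadj _ tN); rewrite E1; lia.
  rewrite leqNgt; apply/negP => lt; apply: (fneq t tN).
  have at1 := fadj t (ltnW tN); rewrite adjC in at1.
  by apply: nlow_unique (low (f t.+1) _) at1 (fadj _ tN) _ _; rewrite ?j0 ?fpos //; lia.
(* The image of the midpoint has at most one neighbor not above it, so the path climbs in at least
   one of its two directions. *)
have [f [f0 f1]] : exists f : nat -> V, (forall t, t <= N ->
    0 < l (f t) /\ phi (f t) = phi z) /\ forall t, t <= N -> l (f t) = l (f 0) + t.
  have [up|nup] := eqVneq (l (g (w N.+1))) (l (g (w N))).+1.
    exists (fun t => g (w (N + t))); split=> [t tN|].
      by split; [apply/cf/gz | apply: gphi]; rewrite leq_add2l.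
    apply: climb => [t tN|t tN|t tN|]; rewrite ?addn0 ?addn1 ?addnS //.
      by apply/cf/gz; rewrite leq_add2l.
  exists (fun t => g (w (N - t))); split=> [t tN|].
    by split; [apply/cf/gz | apply: gphi]; lia.
  apply: climb => [t tN|t tN|t tN|]; rewrite ?subn0.
  - by apply/cf/gz; lia.
  - by rewrite adjC (_ : N - t = (N - t.+1).+1) //; lia.
  - rewrite (_ : N - t = (N - t.+2).+2); last by lia.
    by move=> /esym; apply: gneq.
  have NE : N = N.-1.+1 by [].
  have back : adj (g (w N)) (g (w N.-1)) by rewrite adjC {2}NE.
  rewrite subn1; apply/eqP; rewrite eqn_leq (lev_adj st back) /= ltnNge.
  apply/negP => le; apply: (gneq N.-1); rewrite -NE.
  apply: nlow_unique (low (g (w N)) _) back (gadj N) le _.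
    by rewrite j0; apply/cf/gz; lia.
  by have := lev_adj st (gadj N); rewrite leq_eqVlt (negPf nup) ltnS.
suff : mu = 0 by lia.
apply: (monochrome_levels (a := l (f 0)) (c := phi z)) => y.
move=> /andP[y0 yN]; have tN : l y - l (f 0) <= N by lia.
have [_ <-] := f0 _ tN; apply: (equiv_phi (n := 0)); apply: (lev_equiv st).
by rewrite f1 //; lia.
Qed.

(** * The quotient graph *)

Definition level (i : nat) : set V := [set x | l x = i].

Lemma sim_classE x : sim_class adj phi x = level (l x).
Proof. by apply/seteqP; split=> y /= => [/(lev_sim st)|/esym/(lev_sim st)]. Qed.

Lemma X_verticesE B : X_vertices adj phi B <-> exists i, B = level i.
Proof.
split=> [[x _ <-]|[i ->]]; first by exists (l x); rewrite sim_classE.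
by have [x <-] := lev_surj i; exists x; rewrite // sim_classE.
Qed.

Lemma level_inj : injective level.
Proof.
by move=> i j ij; have [x xi] := lev_surj i; have : level i x := xi; rewrite ij -xi.
Qed.

Lemma level_bij : set_bij [set: nat] (X_vertices adj phi) level.
Proof.
split=> [i _|i j _ _ /level_inj //|B /X_verticesE [i ->]]; last by exists i.
by apply/X_verticesE; exists i.
Qed.

Lemma X_index_level i j n : X_index_is adj (level i) (level j) n <->
  forall x, l x = i -> count (fun y => l y == j) (nb x) = n.
Proof.
have mem x y : (y \in [seq y <- nb x | l y == j])
    = `[< (neighbors adj x `&` level j) y >].
  rewrite mem_filter mem_nb andbC; apply/andP/asboolP => -[xy yj]; split=> //; exact/eqP.
split=> H x xi.
  have /card_eq_seq [s [us <- sE]] := H x xi.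
  rewrite -size_filter; apply/perm_size/uniq_perm => //.
    by rewrite filter_uniq ?nb_uniq.
  by move=> y; rewrite mem sE.
apply/card_eq_seq; exists [seq y <- nb x | l y == j]; split=> //.
  by rewrite filter_uniq ?nb_uniq.
by rewrite size_filter H.
Qed.

Lemma nlow_up x : nlow x + count (fun y => l y == (l x).+1) (nb x) = k.
Proof.
rewrite -(size_nb x) -(count_predC (fun y => l y <= l x)); congr (_ + _).
apply: eq_in_count => y; rewrite mem_nb => /(lev_adj st) xy /=.
by rewrite -ltnNge eqn_leq xy.
Qed.

Lemma up_index_nlow : (forall i, X_index_is adj (level i) (level i.+1) (k - 1) \/
    X_index_is adj (level i) (level i.+1) k) -> forall x, nlow x <= 1.
Proof.
move=> H x; have := nlow_up x.
by have [/X_index_level/(_ x erefl)|/X_index_level/(_ x erefl)] := H (l x); lia.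
Qed.

(** The isomorphism [v] is arbitrary. The index [f i] of level [i] moves by unit steps and
    injectively, so [nat_unit_steps] makes it the identity. *)
Lemma quotient_levels (E : nat -> nat -> Prop) (I : nat -> nat -> nat) :
  quotient_is adj phi (EIGraph E I) ->
  (forall i j, E i j -> [\/ j = i.+1, i = j.+1 | i = 0 /\ j = 0]) ->
  forall i, E i i.+1 -> X_index_is adj (level i) (level i.+1) (I i i.+1).
Proof.
move=> [v [[vfun vinj vsurj] vE vI]] Estep.
have /choice [f fE] : forall i : nat, exists j : nat, v j = level i.
  move=> i; have [|j _ <-] := vsurj (level i); last by exists j.
  by apply/X_verticesE; exists i.
have finj : injective f by move=> i j ij; apply: level_inj; rewrite -!fE ij.
suff fid i : f i = i by move=> i Ei; rewrite -!fE !fid; apply: vI.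
apply: nat_unit_steps => [//||a].
  have /X_verticesE [a va] : X_vertices adj phi (v 0) by apply: vfun.
  by exists a; apply: vinj; rewrite ?inE // fE.
have [x xa] := lev_surj a; have [y xy yE] := lev_up st x.
have : X_edge adj (v (f a)) (v (f a.+1)).
  by rewrite !fE; exists x, y; split=> //; rewrite /level /= yE xa.
move=> /vE/Estep [->|->|[fa faS]]; [by left | by right |].
by have /finj := etrans fa (esym faS); lia.
Qed.

Lemma quotient_nlow : quotient_is adj phi (looped_ray k) \/
  quotient_is adj phi (plain_ray k) -> forall x, nlow x <= 1.
Proof.
case=> [/quotient_levels H | /quotient_levels H]; apply: up_index_nlow => i.
  by left; have := H (fun i j => id) i; rewrite eqxx; apply; constructor 1.
have E a b : b = a.+1 \/ a = b.+1 -> [\/ b = a.+1, a = b.+1 | a = 0 /\ b = 0].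
  by case; [constructor 1 | constructor 2].
have := H E i (or_introl erefl); rewrite eqxx.
by case: (i == 0); [right | left].
Qed.

Hypothesis low : forall x, nlow x <= 1.

(** At positive level the one neighbor that is not above lies one level down, so only level 0 can
    carry a loop. *)
Lemma level_edge i j : X_edge adj (level i) (level j) <->
  [\/ j = i.+1, i = j.+1 | [/\ i = 0, j = 0 & exists x, l x = 0 /\ nlow x = 1]].
Proof.
split=> [[x [y [<- <- xy]]]|[->|->|[-> -> [x [x0 x1]]]]].
- have := lev_adj st xy; have := lev_adjV xy => yx.
  rewrite leq_eqVlt => /orP[/eqP|]; first by constructor 1; lia.
  rewrite ltnS leq_eqVlt => /orP[/eqP lxy|]; last by constructor 2; lia.
  have x0 : l x = 0.
    apply/eqP; apply: contraT; rewrite -lt0n => /(lev_down st) [d xd dE].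
    have dy : d = y by apply: nlow_unique (low x) xd xy _ _; lia.
    by move: dE; rewrite dy; lia.
  constructor 3; split; rewrite ?lxy //; exists x; split=> //.
  apply/eqP; rewrite eqn_leq low /nlow -has_count; apply/hasP.
  by exists y; rewrite ?mem_nb // lxy.
- have [x <-] := lev_surj i; have [y xy yE] := lev_up st x.
  by exists x, y.
- have [x xE] := lev_surj j.+1; have [|y xy yE] := lev_down st (x := x).
    by rewrite xE.
  by exists x, y; split=> //; rewrite /level /=; lia.
- have : 0 < nlow x by rewrite x1.
  rewrite /nlow -has_count => /hasP [y]; rewrite mem_nb x0 leqn0 => xy /eqP y0.
  by exists x, y.
Qed.

Lemma nlow_pos x : 0 < l x -> nlow x = 1.
Proof.
move=> /(lev_down st) [d xd dE]; apply/eqP; rewrite eqn_leq low /nlow -has_count.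
by apply/hasP; exists d; rewrite ?mem_nb // dE.
Qed.

Lemma level_index_up i n : (forall x, l x = i -> nlow x = n) ->
  X_index_is adj (level i) (level i.+1) (k - n).
Proof.
by move=> H; apply/X_index_level => x xi; have := nlow_up x; rewrite (H x xi) xi; lia.
Qed.

Lemma level_index_down j : X_index_is adj (level j.+1) (level j) 1.
Proof.
apply/X_index_level => x xj; have x0 : 0 < l x by rewrite xj.
have /permP/(_ (pred1 j)) := nlow_row x0 (low x).
rewrite count_map /= count_nseq xj /= eqxx (_ : (j.+2 == j) = false); last by lia.
by rewrite mul0n addn0.
Qed.

Lemma nlow_quotient : quotient_is adj phi (looped_ray k) \/
  quotient_is adj phi (plain_ray k).
Proof.
have [x0 x00] := lev_0 st.
(* For a core vertex [nlow] counts its neighbors in the core: one gives the loop, none the plain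
   ray. *)
have [loop|noloop] := eqVneq (nlow x0) 1; [left|right]; exists level; split.
- exact: level_bij.
- move=> i j; split=> [/level_edge [||[-> -> _]]|] /=.
  + by constructor 1.
  + by constructor 2.
  + by constructor 3.
  + move=> ij; apply/level_edge; case: ij => [||[-> ->]].
    * by constructor 1.
    * by constructor 2.
    * by constructor 3; split=> //; exists x0.
- move=> i j /= [->|->|[-> ->]] /=.
  + rewrite eqxx; apply: level_index_up => x xi; case: i xi => [xi|i xi].
      by rewrite (nlow_lev (y := x0)) // x00.
    by apply: nlow_pos; rewrite xi.
  + by rewrite (_ : (j == j.+2) = false); [apply: level_index_down | lia].
  + apply/X_index_level => x xi; rewrite -loop (nlow_lev (x := x0) (y := x)).
      by rewrite /nlow xi; apply: eq_count => y; rewrite leqn0.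
    by rewrite x00 xi.
- exact: level_bij.
- move=> i j; split=> [/level_edge [||[_ _ [x [xi x1]]]]|] /=.
  + by left.
  + by right.
  + by rewrite (nlow_lev (y := x)) ?x1 // x00 in noloop.
  + by move=> ij; apply/level_edge; case: ij; [constructor 1 | constructor 2].
- move=> i j /= [->|->] /=.
  + rewrite eqxx; case: i => [|i] /=.
      rewrite -(subn0 k); apply: level_index_up => x xi.
      rewrite (nlow_lev (y := x0)) ?xi //.
      by have := low x0; move: noloop; case: (nlow x0) => [|[]].
    by apply: level_index_up => x xi; apply: nlow_pos; rewrite xi.
  + by rewrite (_ : (j == j.+2) = false); [apply: level_index_down | lia].
Qed.

(** * Eventual periodicity when [nlow] is at most 1 *)

(** On the way out from a core vertex only the first step can stay in the core: any later step that
    did not climb would lead to a second neighbor that is not above. *)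
Lemma core_dist x y : l x = 0 -> l y = 0 -> dist x y <= 1.
Proof.
move=> x0; have parE' n z : dist x z = n -> z != x ->
    l z = (l (par x z)).+1 \/ par x z = x /\ l z = 0.
  elim/ltn_ind: n z => n IH z zn zx; have [zu uE] := parP zx.
  set u := par x z in zu uE *; have [ux|ux] := eqVneq u x.
    by have := lev_adjV zu; rewrite ux x0; case: (l z) => [|[]]; [right | left | lia].
  have [uw wE] := parP ux; set w := par x u in uw wE *.
  left; have uzl := lev_adjV zu; apply/eqP; rewrite eqn_leq uzl /= ltnNge.
  apply/negP => le; rewrite adjC in zu.
  have zw : z = w.
    apply: nlow_unique (low u) zu uw le _.
    have un : dist x u < n by lia.
    have [->|[wx ->]] := IH _ un u (erefl _) ux; first exact: leqnSn.
    by rewrite /w wx x0.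
  by move: uE; rewrite zw wE; lia.
move=> y0; have [->|yx] := eqVneq y x; first by rewrite distxx.
have [|[yp _]] := parE' _ y (erefl _) yx; first by rewrite y0.
by have [yp' ->] := parP yx; rewrite yp distxx.
Qed.

Lemma lev_head y : 0 < l y -> exists2 h, l h = 1 & l y = (dist h y).+1.
Proof.
elim: {y}(l y) {-2}y (erefl (l y)) => [|[|n] IH] y yE.
- by rewrite yE.
- by exists y; rewrite // distxx.
move=> _.
have [|d yd dE] := lev_down st (x := y); first by rewrite yE.
have [||h h1 hE] := IH d; try lia; exists h => //.
have := lev_dist h y; rewrite adjC in yd; have := dist_adj_le h yd; lia.
Qed.

(** For [l h = 1] this is the branch hanging off the core at [h]. *)
Definition shoot h : set V := [set y | l y = (dist h y).+1].

Lemma shoot_subtree h : l h = 1 -> subtree adj (shoot h).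
Proof.
move=> h1; have hS : shoot h h by rewrite /shoot /= distxx.
have from n y : dist h y = n -> shoot h y ->
    exists p, [/\ path adj h p, last h p = y & forall z, z \in p -> shoot h z].
  elim: n y => [|n IH] y yn Sy.
    by exists [::]; split=> //=; apply/eqP; rewrite -dist_eq0 yn.
  have yh : y != h by rewrite eq_sym -dist_eq0 yn.
  have [yu uE] := parP yh; set u := par h y in yu uE *.
  have Su : shoot h u.
    by have := lev_adjV yu; have := lev_dist h u; rewrite /shoot /= in Sy *; lia.
  have [|p [pp lp pS]] := IH u _ Su; first by lia.
  exists (rcons p y); rewrite rcons_path pp lp adjC yu last_rcons; split=> // z.
  by rewrite mem_rcons inE => /orP[/eqP -> //|/pS].
split; first by exists h.
move=> x y Sx Sy; have [p [pp lp pS]] := from _ x (erefl _) Sx.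
have [q [pq lq qS]] := from _ y (erefl _) Sy.
have lr : last x (rev (belast h p)) = h.
  by case: p lp {pp pS} => [|a p] //= _; rewrite rev_cons last_rcons.
exists (rev (belast h p) ++ q); rewrite cat_path last_cat lr pq lq; split=> //.
  by rewrite andbT -lp rev_path; apply: sub_path pp => a b; rewrite /= adjC.
move=> z; rewrite mem_cat mem_rev => /orP[/mem_belast|/qS //].
by rewrite inE => /orP[/eqP ->|/pS].
Qed.

Lemma level_color_periodic : exists2 P, 0 < P &
  forall x y, 0 < l x -> l y = l x + P -> phi y = phi x.
Proof.
have [q qE] := lev_class.
have [|P P0 qP] := lev_class_periodic (j := 0) _ qE.
  by move=> x _.
exists P => // x y x0 yE; have xy : equiv mu y x.
  by apply/repP; rewrite !qE yE qP.
(* For [mu = 0] level [mu] does not see colors; [lev_far] supplies the one extra level. *)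
by apply: (equiv_phi (n := mu)); rewrite -addn1; apply: (lev_far st xy); lia.
Qed.

Lemma shoot_periodic h : l h = 1 -> exists psi : V -> A,
  periodic adj psi /\ forall x, shoot h x -> psi x = phi x.
Proof.
move=> h1; have [|p hp] := lev_down st (x := h); first by rewrite h1.
rewrite h1 => -[/esym p0]; have [P P0 colP] := level_color_periodic.
(* The ray starts at [h] and leaves through the core vertex [p], so on [shoot h] its Busemann
   function is [dist h x], that is, [l x - 1]; hence the successor in [psi]. *)
have [r [r0 r1 ray]] := exists_ray hp.
have [X XE] := choice lev_surj; exists (fun x => phi (X (horo P r x).+1)).
split; first exact: (horo_periodic P0 ray (fun t => phi (X t.+1))).
move=> x hx; have rec : receding r x 0.
  rewrite /receding r0 r1; have := dist_adj_cases x hp.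
  by have := lev_dist p x; rewrite hx p0 (distC h) (distC p); lia.
rewrite (horoE P0 ray rec) /horo_at mul0n addn0 r0 distC.
transitivity (phi (X (l x))); last first.
  by apply: (equiv_phi (n := 0)); apply: (lev_equiv st); rewrite XE.
rewrite hx [in RHS](divn_eq (dist h x) P); elim: (_ %/ _) => // d IH.
by rewrite IH; apply/esym/colP; rewrite !XE // mulSn; lia.
Qed.

Lemma nlow_eventually_periodic : eventually_periodic adj phi.
Proof.
have [x0 x00] := lev_0 st.
have coreS y : l y = 0 -> y \in x0 :: nb x0.
  move=> y0; have := core_dist x00 y0; rewrite leq_eqVlt ltnS leqn0 dist_eq0.
  by move=> /orP[/eqP/dist1_adj d1|/eqP <-]; rewrite inE ?eqxx // mem_nb d1 orbT.
exists (level 0); split.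
- split; first by exists x0.
  move=> x y x0' y0; have := core_dist x0' y0.
  rewrite leq_eqVlt ltnS leqn0 dist_eq0 => /orP[/eqP/dist1_adj xy|/eqP <-].
    by exists [:: y]; rewrite /= xy; split=> // z; rewrite inE => /eqP ->.
  by exists [::].
- apply: (sub_finite_set (B := [set` x0 :: nb x0])) => [y /coreS //|].
  by apply/finite_seqP; exists (x0 :: nb x0).
pose hs := [seq h <- flatten (map nb (x0 :: nb x0)) | l h == 1].
have hsP h : l h = 1 -> h \in hs.
  move=> h1; rewrite mem_filter h1 eqxx; have [|d hd dE] := lev_down st (x := h).
    by rewrite h1.
  apply/flattenP; exists (nb d); last by rewrite mem_nb adjC.
  by apply: map_f; apply: coreS; lia.
have hs1 (i : 'I_(size hs)) : l (tnth (in_tuple hs) i) = 1.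
  by have := mem_tnth i (in_tuple hs); rewrite mem_filter => /andP[/eqP].
exists (size hs), (fun i => shoot (tnth (in_tuple hs) i)); split.
  apply/seteqP; split=> [y /= /eqP|y [i _]]; last by rewrite /shoot /level /= => ->.
  rewrite -lt0n => /lev_head [h /hsP hh yE].
  by have /tnthP [i hi] : h \in in_tuple hs := hh; exists i; rewrite // /shoot /= -hi.
by move=> i; split; [apply: shoot_subtree | apply: shoot_periodic].
Qed.

End Levels.
End Coloring.
End Tree.

Theorem theorem7 (k : nat) (hk : (2 <= k)%N)
    (V : choiceType) (adj : rel V) (hT : regular_tree adj k)
    (A : countType) (phi : V -> A)
    (hsturmian : sturmian adj phi) (hbounded : bounded_type adj phi) :
  eventually_periodic adj phi <->
  (quotient_is adj phi (looped_ray k) \/ quotient_is adj phi (plain_ray k)).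
Proof.
have [tr hreg] := hT.
have [mu [l st]] := sturmian_stratification tr hreg hk hsturmian hbounded.
split=> [hper|].
  apply: (nlow_quotient tr hreg hk st).
  exact: (eventually_periodic_nlow tr hreg hk hsturmian st hper).
move=> /(quotient_nlow tr hreg hk st).
exact: (nlow_eventually_periodic tr hreg hk hsturmian st).
Qed.
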